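(* Let $u:\mathbb{R}^2\to\mathbb{R}$ be a smooth radially symmetric function satisfying $\Delta u+e^{2u}\le 0$ in $\mathbb{R}^2$, and let $g=e^{2u}\delta$, where $\delta$ is the Euclidean metric. For $r>0$ put $$l(r)=\int_{\partial B_r}e^{u}\,ds,\quad A(r)=\int_{B_r}e^{2u}\,dx,\quad A_\infty=\int_{\mathbb{R}^2}e^{2u}\,dx,\quad R=R(r)=\int_0^r e^{u(\rho)}\,d\rho .$$ Then: (1) $\mathrm{vol}_g(\mathbb{R}^2)\le 4\pi$ and $\mathrm{diam}_g(\mathbb{R}^2)\le\pi$. (2) There exists $r_0>0$ such that $l$ is increasing for $r<r_0$ and decreasing for $r>r_0$. Moreover, $$\max_{r>0}l(r)=l(r_0)\le 2\pi\qquad\text{and}\qquad \lim_{r\to\infty}l(r)=0 .$$ (3) For any $r>0$ (with $A=A(r)$, $l=l(r)$), $$A(A_\infty-A)\le l^2\le 4\pi A-A^2 .$$ (4) With $r_0$ as in (2), $R(r_0)\le \dfrac{\pi}{2}$; and for any $r>0$, $$A_\infty(1-\cos R)\le 2A\qquad\text{and}\qquad \frac{A}{l}\ge\frac{1-\cos R}{\sin R} .$$ (5) If $r\le r_0$, then $\dfrac{A}{l}\le \sin R$. In particular, if $r\le r_0$, then $A(r)\le l(r)$. (6) If $R=R(r)\ge\dfrac{\pi}{2}$, then $A\ge \dfrac{A_\infty}{2}$.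
   Context: $B_r$ is the Euclidean disk of radius $r$ centered at the origin in $\mathbb{R}^2$, and $ds$ is the Euclidean length element; $u(\rho)$ denotes the value of the radial function $u$ at points with $|x|=\rho$. $\mathrm{vol}_g(\mathbb{R}^2)=\int_{\mathbb{R}^2}e^{2u}\,dx$. $d_g(x,y)$ is the infimum of the $g$-lengths of piecewise smooth curves from $x$ to $y$ (the length of $\gamma:[a,b]\to\mathbb{R}^2$ being $\int_a^b e^{u(\gamma(t))}|\gamma'(t)|\,dt$), and $\mathrm{diam}_g(\mathbb{R}^2)=\sup_{x,y} d_g(x,y)$. *)

(* Defs.v *)
From HB Require Import structures.
From mathcomp Require Import all_boot all_order all_algebra.
From mathcomp Require Import all_classical all_reals all_analysis.

Set Implicit Arguments.
Unset Strict Implicit.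
Unset Printing Implicit Defensive.

Import Order.TTheory GRing.Theory Num.Theory.
Import numFieldNormedType.Exports.

Local Open Scope classical_set_scope.
Local Open Scope ring_scope.

(* The plane is R * R.  Its canonical norm `|p| is the sup norm, hence a
   separate Euclidean norm; topology and derivatives do not depend on this. *)
Definition enorm (R : realType) (p : R * R) : R :=
  Num.sqrt (p.1 ^+ 2 + p.2 ^+ 2).

Definition edisk (R : realType) (r : R) : set (R * R) :=
  [set p | enorm p < r].

Definition e1 (R : realType) : R * R := (1, 0).
Definition e2 (R : realType) : R * R := (0, 1).
Arguments e1 {R}.
Arguments e2 {R}.

Fixpoint is_Ck (R : realType) (k : nat) (f : R * R -> R) : Prop :=
  continuous f /\
  match k with
  | 0%N => True
  | k'.+1 => [/\ forall p, derivable f p e1, forall p, derivable f p e2,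
                 is_Ck k' ('D_e1 f) & is_Ck k' ('D_e2 f)]
  end.

Definition smooth (R : realType) (f : R * R -> R) : Prop :=
  forall k, is_Ck k f.

Definition radially_symmetric (R : realType) (f : R * R -> R) : Prop :=
  forall p q, enorm p = enorm q -> f p = f q.

Definition laplacian (R : realType) (f : R * R -> R) (p : R * R) : R :=
  'D_e1 ('D_e1 f) p + 'D_e2 ('D_e2 f) p.

Definition smooth_curve (R : realType) (c : R -> R * R) : Prop :=
  forall n t, derivable (c^`(n)%classic) t 1.

(* Smoothness on a closed piece, up to its end points, is the existence of a
   smooth extension to the whole line.  Curves are total functions; values
   outside `[a, b] are irrelevant. *)
Definition piecewise_smooth (R : realType) (a b : R) (c : R -> R * R) : Prop :=
  {within `[a, b], continuous c} /\
  exists2 s : seq R, itv_partition a b s &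
    forall i, (i < size s)%N ->
      exists2 h : R -> R * R, smooth_curve h &
        {in `[nth a (a :: s) i, nth a s i], c =1 h}.

(* The integral of f along c with respect to Euclidean length.  The derivative
   c^`() may be meaningless at the finitely many break points of a piecewise
   smooth c; these form a null set. *)
Definition curve_integral (R : realType) (f : R * R -> R) (a b : R)
    (c : R -> R * R) : \bar R :=
  (\int[lebesgue_measure]_(t in `[a, b]) (f (c t) * enorm (c^`()%classic t))%:E)%E.

Definition circle (R : realType) (r t : R) : R * R := (r * cos t, r * sin t).

Section conformal_metric.
Variables (R : realType) (u : R * R -> R).

Definition garea (D : set (R * R)) : \bar R :=
  (\int[(lebesgue_measure \x lebesgue_measure)%E]_(p in D)
     (expR (2 * u p))%:E)%E.

Definition gvol : \bar R := garea setT.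

Definition glength (a b : R) (c : R -> R * R) : \bar R :=
  curve_integral (fun p => expR (u p)) a b c.

Definition gdist (x y : R * R) : \bar R :=
  ereal_inf [set L | exists a b c,
    [/\ a < b, piecewise_smooth a b c, c a = x, c b = y & L = glength a b c]].

Definition gdiam : \bar R :=
  ereal_sup [set d | exists x y, d = gdist x y].

Definition circle_length (r : R) : R :=
  fine (curve_integral (fun p => expR (u p)) 0 (2 * pi) (circle r)).

Definition disk_area (r : R) : R := fine (garea (edisk r)).

(* Meaningful when [gvol] is finite: [fine +oo] is 0. *)
Definition total_area : R := fine gvol.

(* For radial u, the value u(rho) is the one at (rho, 0). *)
Definition gradius (r : R) : R :=
  \int[lebesgue_measure]_(rho in `[0, r]) expR (u (rho, 0)).

End conformal_metric.

(* Main.v *)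
Require Import Defs.
From HB Require Import structures.
From mathcomp Require Import all_boot all_order all_algebra.
From mathcomp Require Import all_classical all_reals all_analysis.
From mathcomp Require Import measurable_realfun ring lra.

Set Implicit Arguments.
Unset Strict Implicit.
Unset Printing Implicit Defensive.

Import Order.TTheory GRing.Theory Num.Theory.
Import numFieldNormedType.Exports.

Local Open Scope classical_set_scope.
Local Open Scope ring_scope.

(** Write [E = e^u] for the conformal factor on the half line, [T] for the
    [g]-distance to the origin, [L = r E] and [a] for [l / 2 pi] and [A / 2 pi],
    and [h = 1 + r u'].  The metric is [dT^2 + L^2 dtheta^2], so with respect to
    the arc length [T] the function [h] is the derivative of [L] and [L] is the
    derivative of [a].  The Laplacian of a radial function being
    [u'' + u' / r], the hypothesis says that [h] decreases at least as fast as
    [a] increases, that is [L'' <= - L]: the curvature is at least [1].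
    Everything is Sturm comparison with the unit sphere, where [L = sin T],
    [h = cos T] and [a = 1 - cos T].

    Isoperimetric inequalities.  [h + a] is nonincreasing and equals [1] at the
    origin, so the derivative of [2 a - a^2 - L^2] is nonnegative; this gives
    [l^2 <= 4 pi A - A^2], then [a <= 2] and [L <= 1].  The derivative of
    [L^2 - a (aoo - a)] has the sign of [2 (h + a) - aoo], which changes at most
    once, from plus to minus; the function is therefore at least the smaller
    of its value at the origin and its lower limit at infinity, both
    nonnegative ([rp_isoperimetric], [rp_reverse_isoperimetric]).

    Shape of [L].  [h] decreases strictly.  If [L] stayed above some [c > 0],
    then [da/dr = L^2 / r] would make [a] grow like a logarithm, against
    [a <= 2].  Hence [h] has a unique zero [r0], and [L] tends to [0]
    ([rp_turning_point], [rp_L_cvg0]).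

    Comparison with the sphere.  The Wronskian of [L] and [sin T] has a sign as
    long as [T <= pi], which prevents [T] from reaching [pi], puts [T (r0)] at
    most at [pi / 2], and makes [L / sin T] nonincreasing; integrating this
    compares the areas with those of spherical caps, and [T >= pi / 2] is the
    case of a cap that contains a hemisphere ([rp_sturm], [rp_L_sin], [rp_cap],
    [rp_cap_ratio]).  For the bound [A / l <= sin T] the comparison function is
    [cos (T (r) - T)], which has its maximum at the end point [r]
    ([rp_L_cos], [rp_a_le_Lsin]).

    Diameter.  Two points can be joined through the origin, at the cost of
    [T (x) + T (y)], or by going out along rays to a large circle, whose length
    tends to [0], at a cost close to [2 T (oo) - T (x) - T (y)].  As
    [T (oo) <= pi], the smaller of both is at most [pi] ([gdist_le_pi]).

    The quantities of the statement are Lebesgue integrals.  The disk area is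
    differentiated by squeezing the conformal area of a thin annulus between
    multiples of its Euclidean area [pi (s^2 - r^2)] ([is_derive_disk_area]). *)

(** * Monotonicity from derivatives *)

Lemma derive_ge0_le (R : realType) (F dF : R -> R) (a b : R) :
  a <= b -> continuous F ->
  (forall x, a < x < b -> is_derive x 1 F (dF x) /\ 0 <= dF x) ->
  F a <= F b.
Proof.
rewrite le_eqVlt => /predU1P[->//|ab] cF dF0.
have [x||c] := MVT (f := F) (df := dF) ab.
- by move=> /[!in_itv]/= xab; have [] := dF0 x xab.
- exact: continuous_subspaceT.
- move=> /[!in_itv]/= /dF0[_ dFc] FE.
  by rewrite -subr_ge0 FE mulr_ge0// subr_ge0 ltW.
Qed.

Lemma derive_ge0_le_cc (R : realType) (F dF : R -> R) (a b : R) :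
  a <= b ->
  (forall x, a <= x <= b -> is_derive x 1 F (dF x) /\ 0 <= dF x) ->
  F a <= F b.
Proof.
rewrite le_eqVlt => /predU1P[->//|ab] dF0.
have [x||c] := MVT (f := F) (df := dF) ab.
- by move=> /subset_itv_oo_cc /[!in_itv]/= xab; have [] := dF0 x xab.
- apply: derivable_within_continuous => x /[!in_itv]/= /dF0[Fx _].
  exact: ex_derive.
- move=> /subset_itv_oo_cc /[!in_itv]/= /dF0[_ dFc] FE.
  by rewrite -subr_ge0 FE mulr_ge0// subr_ge0 ltW.
Qed.

Lemma is_derive_div (R : realType) (f g : R -> R) (x df dg : R) :
  g x != 0 -> is_derive x 1 f df -> is_derive x 1 g dg ->
  is_derive x 1 (fun y => f y / g y) ((df * g x - f x * dg) / g x ^+ 2).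
Proof.
move=> gx0 Hf Hg.
have HV : is_derive x 1 (fun y => (g y)^-1) (- (g x) ^- 2 * dg).
  apply: DeriveDef; first by apply: derivableV => //; exact: ex_derive.
  by rewrite deriveV// ?derive_val//; exact: ex_derive.
rewrite -[X in is_derive _ _ X _]/(f * (fun y => (g y)^-1)).
by apply: is_derive_eq; rewrite /GRing.scale/=; field.
Qed.

(** The monotonicity of [f / g] in cross-multiplied form, with the Wronskian
    condition as hypothesis: comparisons with the sphere all have this shape. *)
Lemma quotient_ndecr (R : realType) (f g df dg : R -> R) (a b : R) :
  a <= b ->
  (forall x, a <= x <= b -> [/\ 0 < g x, is_derive x 1 f (df x),
     is_derive x 1 g (dg x) & f x * dg x <= df x * g x]) ->
  f a * g b <= f b * g a.
Proof.
move=> ab H.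
have [ga0 _ _ _] : _ := H a ltac:(by rewrite lexx).
have [gb0 _ _ _] : _ := H b ltac:(by rewrite ab lexx).
rewrite -ler_pdivlMr// mulrAC -ler_pdivrMr//.
apply: (@derive_ge0_le_cc R (fun y => f y / g y)
  (fun x => (df x * g x - f x * dg x) / g x ^+ 2) _ _ ab).
move=> x /H[gx0 Hf Hg Hd]; split; first by apply: is_derive_div; rewrite ?gt_eqF.
by rewrite divr_ge0 ?sqr_ge0// subr_ge0.
Qed.

Lemma derive_gt0_lt (R : realType) (F dF : R -> R) (a b : R) :
  a < b -> continuous F ->
  (forall x, a < x < b -> is_derive x 1 F (dF x) /\ 0 < dF x) ->
  F a < F b.
Proof.
move=> ab cF dF0.
have [x||c] := MVT (f := F) (df := dF) ab.
- by move=> /[!in_itv]/= xab; have [] := dF0 x xab.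
- exact: continuous_subspaceT.
- move=> /[!in_itv]/= /dF0[_ dFc] FE.
  by rewrite -subr_gt0 FE mulr_gt0// subr_gt0.
Qed.

(** * Radial profiles of curvature at least one *)

(** The data of a metric [dT^2 + L^2 dtheta^2] of curvature at least [1],
    parametrized by the Euclidean radius; hence the factor [E = dT/dr] in the
    derivatives.  [k] is the derivative of [h], and its bound is [L'' <= - L].
    Continuity on the whole line, rather than on a half line, is available
    because area and distance to the origin are [0] for [r <= 0]. *)
Record radial_profile (R : realType) (E L h k a T : R -> R) : Prop := {
  rp_cL : continuous L;
  rp_ch : continuous h;
  rp_ca : continuous a;
  rp_cT : continuous T;
  rp_L0 : L 0 = 0;
  rp_h0 : h 0 = 1;
  rp_a0 : a 0 = 0;
  rp_T0 : T 0 = 0;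
  rp_E0 : forall r : R, 0 < r -> 0 < E r;
  rp_LE : forall r : R, 0 < r -> L r = r * E r;
  rp_dL : forall r : R, 0 < r -> is_derive r 1 L (h r * E r);
  rp_da : forall r : R, 0 < r -> is_derive r 1 a (L r * E r);
  rp_dT : forall r : R, 0 < r -> is_derive r 1 T (E r);
  rp_dh : forall r : R, 0 < r -> is_derive r 1 h (k r);
  rp_k : forall r : R, 0 < r -> k r <= - (L r * E r) }.

Section profile.
Variables (R : realType) (E L h k a T : R -> R).
Hypothesis P : radial_profile E L h k a T.

Lemma rp_L_gt0 r : 0 < r -> 0 < L r.
Proof. by move=> r0; rewrite (rp_LE P)// mulr_gt0// (rp_E0 P). Qed.

Lemma rp_T_lt r s : 0 <= r -> r < s -> T r < T s.
Proof.
move=> r0 rs; apply: (derive_gt0_lt (dF := E)) => //; first exact: rp_cT P.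
move=> x /andP[rx _]; have x0 : 0 < x by exact: le_lt_trans rx.
by split; [exact: rp_dT P _ _|exact: rp_E0 P _ _].
Qed.

Lemma rp_a_lt r s : 0 <= r -> r < s -> a r < a s.
Proof.
move=> r0 rs; apply: (derive_gt0_lt (dF := fun r => L r * E r)) => //.
  exact: rp_ca P.
move=> x /andP[rx _]; have x0 : 0 < x by exact: le_lt_trans rx.
split; first exact: rp_da P _ _.
by rewrite mulr_gt0 ?rp_L_gt0 ?(rp_E0 P).
Qed.

Lemma rp_T_gt0 r : 0 < r -> 0 < T r.
Proof. by move=> r0; rewrite -(rp_T0 P) rp_T_lt. Qed.

Lemma rp_a_gt0 r : 0 < r -> 0 < a r.
Proof. by move=> r0; rewrite -(rp_a0 P) rp_a_lt. Qed.

(** Gauss-Bonnet: [1 - h] is the total curvature of the disk over [2 pi], which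
    grows at least as fast as its area. *)
Lemma rp_ha_le r s : 0 <= r -> r <= s -> h s + a s <= h r + a r.
Proof.
move=> r0 rs; rewrite -lerN2.
apply: (@derive_ge0_le R (- (h + a)) (fun x => - (k x + L x * E x)) _ _ rs).
  by move=> x; apply: continuousN; apply: continuousD;
    [exact: rp_ch P _|exact: rp_ca P _].
move=> x /andP[rx _]; have x0 : 0 < x by exact: le_lt_trans rx.
have ? := rp_dh P x0; have ? := rp_k P x0; have ? := rp_da P x0.
split; last by rewrite oppr_ge0; lra.
exact: is_deriveN.
Qed.

Lemma rp_ha_le1 r : 0 <= r -> h r + a r <= 1.
Proof. by move=> r0; have := rp_ha_le (lexx 0) r0; rewrite (rp_h0 P) (rp_a0 P) addr0. Qed.

Lemma rp_h_lt r s : 0 <= r -> r < s -> h s < h r.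
Proof. by move=> r0 rs; have := rp_ha_le r0 (ltW rs); have := rp_a_lt r0 rs; lra. Qed.

(** The difference of both sides vanishes at the origin and has derivative
    [2 L E (1 - (h + a))]. *)
Lemma rp_isoperimetric r : 0 <= r -> L r ^+ 2 <= 2 * a r - a r ^+ 2.
Proof.
move=> r0.
suff : 2 * a 0 - a 0 * a 0 - L 0 * L 0 <= 2 * a r - a r * a r - L r * L r.
  by rewrite (rp_a0 P) (rp_L0 P); lra.
apply: (@derive_ge0_le R (2 \*: a - a * a - L * L)
    (fun x => 2 * L x * E x * (1 - (h x + a x))) _ _ r0).
  move=> x; apply: continuousB; first apply: continuousB.
  - by apply: continuousZr; exact: rp_ca P _.
  - by apply: continuousM; exact: rp_ca P _.
  - by apply: continuousM; exact: rp_cL P _.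
move=> x /andP[x0 _]; have ? := rp_da P x0; have ? := rp_dL P x0.
split; last first.
  rewrite mulr_ge0 ?subr_ge0 ?rp_ha_le1 ?(ltW x0)//.
  by rewrite !mulr_ge0 ?(ltW (rp_L_gt0 _)) ?(ltW (rp_E0 P _)).
apply: is_derive_eq; rewrite /GRing.scale/=; ring.
Qed.

(** The Wronskian [L cos T - h sin T] vanishes at the origin and has derivative
    [- (k + L E) sin T], nonnegative up to [T = pi]. *)
Lemma rp_sturm r : 0 <= r -> T r <= pi -> h r * sin (T r) <= L r * cos (T r).
Proof.
move=> r0 Tpi; rewrite -subr_ge0.
suff : L 0 * cos (T 0) - h 0 * sin (T 0) <= L r * cos (T r) - h r * sin (T r).
  by rewrite (rp_L0 P) (rp_T0 P) sin0 mul0r mulr0 subr0.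
apply: (@derive_ge0_le R (L * (cos \o T) - h * (sin \o T))
    (fun x => - (k x + L x * E x) * sin (T x)) _ _ r0).
  have cT := rp_cT P.
  move=> x; apply: continuousB; apply: continuousM.
  - exact: rp_cL P _.
  - by apply: continuous_comp; [exact: cT|exact: continuous_cos].
  - exact: rp_ch P _.
  - by apply: continuous_comp; [exact: cT|exact: continuous_sin].
move=> x /andP[x0 xr]; have ? := rp_dh P x0; have ? := rp_k P x0.
have ? := rp_dT P x0; have ? := rp_dL P x0.
split; last first.
  rewrite mulr_ge0//; first by rewrite oppr_ge0; lra.
  by rewrite sin_ge0_pi// (ltW (rp_T_gt0 _))//= (le_trans _ Tpi)// ltW// rp_T_lt// ltW.
apply: is_derive_eq; rewrite /GRing.scale/=; ring.
Qed.

(** At a point where [T = pi], [rp_sturm] would read [0 <= - L]. *)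
Lemma rp_T_lt_pi r : 0 <= r -> T r < pi.
Proof.
move=> r0; rewrite ltNge; apply/negP => piT.
have [||s /[!in_itv]/= /andP[s0 sr] Ts] := IVT (f := T) (v := pi) r0.
- by apply: continuous_subspaceT; exact: rp_cT P.
- by rewrite (rp_T0 P) ge_min le_max pi_ge0 piT orbT.
have {}s0 : 0 < s.
  rewrite lt_neqAle s0 andbT; apply/negP => /eqP s0'.
  by move: Ts (@pi_gt0 R); rewrite -s0' (rp_T0 P) => ->; rewrite ltxx.
have := rp_sturm (ltW s0); rewrite Ts lexx sinpi cospi => /(_ isT).
by have := rp_L_gt0 s0; lra.
Qed.

Lemma rp_sin_gt0 r : 0 < r -> 0 < sin (T r).
Proof. by move=> r0; rewrite sin_gt0_pi// rp_T_gt0// rp_T_lt_pi// ltW. Qed.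

Lemma rp_cos_lt1 r : 0 < r -> cos (T r) < 1.
Proof.
move=> r0; rewrite -cos0 ltr_cos ?in_itv/= ?lexx ?pi_ge0 ?rp_T_gt0//.
by rewrite (ltW (rp_T_gt0 _))//= ltW// rp_T_lt_pi// ltW.
Qed.

(** The derivative of [L / sin T] has the sign of the Wronskian in [rp_sturm]. *)
Lemma rp_L_sin s r : 0 < s -> s <= r -> L r * sin (T s) <= L s * sin (T r).
Proof.
move=> s0 sr; have r0 : 0 < r by exact: lt_le_trans sr.
rewrite mulrC [X in _ <= X]mulrC.
apply: (quotient_ndecr (f := sin \o T) (df := fun x => cos (T x) * E x)
  (dg := fun x => h x * E x) sr) => x /andP[sx xr].
have x0 : 0 < x by exact: lt_le_trans sx.
have ? := rp_dL P x0; have ? := rp_dT P x0.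
split; [exact: rp_L_gt0|exact: is_derive1_comp|by []|].
rewrite /= mulrA [X in _ <= X]mulrAC (ler_pM2r (rp_E0 P x0)) mulrC [X in _ <= X]mulrC.
by rewrite rp_sturm ?ltW ?rp_T_lt_pi ?ltW.
Qed.

(** [L x >= (L r / sin (T r)) sin (T x)] for [x <= r], integrated from [0] to [r]. *)
Lemma rp_cap r : 0 < r -> L r * (1 - cos (T r)) <= a r * sin (T r).
Proof.
move=> r0.
suff : a 0 * sin (T r) + L r * cos (T 0) <= a r * sin (T r) + L r * cos (T r).
  by rewrite (rp_a0 P) (rp_T0 P) cos0; lra.
apply: (@derive_ge0_le R (a * cst (sin (T r)) + L r \*: (cos \o T))
    (fun x => E x * (L x * sin (T r) - L r * sin (T x))) _ _ (ltW r0)).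
  move=> x; apply: continuousD.
    by apply: continuousM; [exact: rp_ca P _|exact: cvg_cst].
  apply: continuousZr; apply: continuous_comp; first exact: rp_cT P _.
  exact: continuous_cos.
move=> x /andP[x0 xr]; have ? := rp_da P x0; have ? := rp_dT P x0.
split; last by rewrite mulr_ge0 ?(ltW (rp_E0 P _))// subr_ge0 rp_L_sin// ltW.
by apply: is_derive_eq; rewrite /GRing.scale/=; ring.
Qed.

(** The area divided by the area of the spherical cap of the same radius is
    nonincreasing: its derivative has the sign of the difference in [rp_cap]. *)
Lemma rp_cap_ratio s r : 0 < s -> s <= r ->
  a r * (1 - cos (T s)) <= a s * (1 - cos (T r)).
Proof.
move=> s0 sr; rewrite mulrC [X in _ <= X]mulrC.
apply: (quotient_ndecr (f := cst 1 - (cos \o T)) (g := a)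
  (df := fun x => sin (T x) * E x)
  (dg := fun x => L x * E x) sr) => x /andP[sx xr].
have x0 : 0 < x by exact: lt_le_trans sx.
have ? := rp_da P x0; have ? := rp_dT P x0.
split; [exact: rp_a_gt0| |by []|].
  by apply: is_derive_eq; rewrite /GRing.scale/=; ring.
rewrite /= mulrA [X in _ <= X]mulrAC (ler_pM2r (rp_E0 P x0)).
by rewrite mulrC [X in _ <= X]mulrC; exact: rp_cap.
Qed.

(** [rp_sturm] with [0 <= h r] forces [cos (T r)] to be nonnegative. *)
Lemma rp_T_le_pihalf r : 0 < r -> 0 <= h r -> T r <= pi / 2.
Proof.
move=> r0 hr; rewrite leNgt; apply/negP => piT.
have Tpi := rp_T_lt_pi (ltW r0).
have := rp_sturm (ltW r0) (ltW Tpi); apply/negP; rewrite -ltNge.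
apply: (@lt_le_trans _ _ 0); last by rewrite mulr_ge0// ltW// rp_sin_gt0.
rewrite pmulr_rlt0 ?rp_L_gt0//.
have -> : T r = T r - pi / 2 + pi / 2 by rewrite subrK.
rewrite cosDpihalf oppr_lt0 sin_gt0_pihalf// subr_gt0 piT/= ltrBlDr.
by rewrite -splitr.
Qed.

(** The comparison function is the solution of [L'' = - L] with maximum [L r] at
    [r]; the Wronskian with it decreases to the value [h r >= 0]. *)
Lemma rp_L_cos s r : 0 < s -> s <= r -> 0 <= h r ->
  L s <= L r * cos (T r - T s).
Proof.
move=> s0 sr hr; have r0 : 0 < r by exact: lt_le_trans sr.
have Tr := rp_T_le_pihalf r0 hr.
have Tx x : 0 < x -> x <= r -> 0 <= T r - T x < pi / 2.
  move=> x0 xr; have := rp_T_gt0 x0.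
  have : T x <= T r.
    by move: xr; rewrite le_eqVlt => /predU1P[->//|xr]; rewrite ltW// rp_T_lt// ltW.
  by lra.
have cos_gt0 x : 0 < x -> x <= r -> 0 < cos (T r - T x).
  move=> x0 xr; have := Tx x x0 xr => /andP[? ?]; apply: cos_gt0_pihalf.
  by apply/andP; split=> //; have := @pi_gt0 R; lra.
have W x : 0 < x -> x <= r ->
    0 <= h x * cos (T r - T x) - L x * sin (T r - T x).
  move=> x0 xr; apply: (le_trans hr).
  have -> : h r = h r * cos (T r - T r) - L r * sin (T r - T r).
    by rewrite subrr cos0 sin0 mulr1 mulr0 subr0.
  rewrite -lerN2.
  apply: (@derive_ge0_le_cc R
    (- (h * (cos \o (cst (T r) - T)) - L * (sin \o (cst (T r) - T))))
    (fun x => - (k x + L x * E x) * cos (T r - T x)) _ _ xr) => y /andP[xy yr].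
  have y0 : 0 < y by exact: lt_le_trans xy.
  have ? := rp_dh P y0; have ? := rp_k P y0; have ? := rp_dL P y0.
  have ? := rp_dT P y0; split; last first.
    rewrite mulr_ge0//; first by rewrite oppr_ge0; lra.
    by rewrite ltW// cos_gt0.
  apply: is_derive_eq; rewrite /GRing.scale/=.
  rewrite -!/((cst (T r) - T) y) -![(cst (T r) - T) y]/(T r - T y); ring.
have := quotient_ndecr (f := L) (g := cos \o (cst (T r) - T))
  (df := fun x => h x * E x)
  (dg := fun x => sin (T r - T x) * E x) sr.
rewrite /= -![(cst (T r) - T) _]/(T r - T _) subrr cos0 mulr1; apply.
move=> x /andP[sx xr]; have x0 : 0 < x by exact: lt_le_trans sx.
have ? := rp_dL P x0; have ? := rp_dT P x0.
split; [exact: cos_gt0|by []| |].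
  by apply: is_derive_eq; rewrite /GRing.scale/= -![(cst (T r) - T) _]/(T r - T _); ring.
rewrite /= mulrA [X in _ <= X]mulrAC (ler_pM2r (rp_E0 P x0)) -subr_ge0.
exact: W.
Qed.

(** [rp_L_cos] integrated from [0] to [r]. *)
Lemma rp_a_le_Lsin r : 0 < r -> 0 <= h r -> a r <= L r * sin (T r).
Proof.
move=> r0 hr.
suff : - (L r * sin (T r - T 0)) - a 0 <= - (L r * sin (T r - T r)) - a r.
  by rewrite (rp_a0 P) (rp_T0 P) !subr0 subrr sin0; lra.
apply: (@derive_ge0_le R (- (L r \*: (sin \o (cst (T r) - T))) - a)
    (fun x => (L r * cos (T r - T x) - L x) * E x) _ _ (ltW r0)).
  move=> x; apply: continuousB; last exact: rp_ca P _.
  apply: continuousN; apply: continuousZr; apply: continuous_comp; last exact: continuous_sin.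
  by apply: continuousB; [exact: cvg_cst|exact: rp_cT P _].
move=> x /andP[x0 xr]; have ? := rp_da P x0; have ? := rp_dT P x0.
split; last by rewrite mulr_ge0 ?(ltW (rp_E0 P _))// subr_ge0 rp_L_cos// ltW.
apply: is_derive_eq; rewrite /GRing.scale/= -![(cst (T r) - T) _]/(T r - T _); ring.
Qed.

Lemma rp_a_le2 r : 0 < r -> a r <= 2.
Proof.
move=> r0; have a0 := rp_a_gt0 r0.
have : 0 <= a r * (2 - a r).
  by apply: le_trans (sqr_ge0 (L r)) _; have := rp_isoperimetric (ltW r0); lra.
by rewrite pmulr_rge0// subr_ge0.
Qed.

(** [da/dr = L^2 / r] would be at least [c^2 / r], so [a] would be unbounded. *)
Lemma rp_L_not_bounded_below r c : 0 < r -> 0 < c -> ~ (forall s, r <= s -> c <= L s).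
Proof.
move=> r0 c0 cL.
(* At this [s] the logarithmic lower bound for [a] equals [a r + 3 > 2]. *)
pose s := r * expR (3 / c ^+ 2).
have c20 : 0 < c ^+ 2 by rewrite exprn_gt0.
have rs : r <= s.
  by rewrite ler_peMr ?(ltW r0)// -expR0 ler_expR divr_ge0// ltW.
have s0 : 0 < s by exact: lt_le_trans rs.
have : a r - c ^+ 2 * ln r <= a s - c ^+ 2 * ln s.
  apply: (@derive_ge0_le_cc R (a - (c ^+ 2) \*: @ln R)
    (fun x => L x * E x - c ^+ 2 / x) _ _ rs) => x /andP[rx xs].
  have x0 : 0 < x by exact: lt_le_trans rx.
  have ? := rp_da P x0; have ? := is_derive1_ln x0.
  split; first exact: is_derive_eq.
  have -> : E x = L x / x by rewrite (rp_LE P)// mulrAC divff ?mul1r// gt_eqF.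
  rewrite mulrA -mulrBl divr_ge0 ?(ltW x0)// subr_ge0 -expr2.
  by rewrite lerXn2r ?nnegrE ?(ltW c0) ?(ltW (rp_L_gt0 _))//; exact: cL.
rewrite /s lnM ?posrE ?expR_gt0// expRK mulrDr mulrCA divff ?gt_eqF//.
by have := rp_a_le2 s0; have := rp_a_gt0 r0; rewrite -/s; lra.
Qed.

End profile.

(** * End behaviour of a radial profile *)

Section profile_end.
Variables (R : realType) (E L h k a T : R -> R).
Hypothesis P : radial_profile E L h k a T.

Lemma rp_L_incr r s : 0 <= r -> r < s -> 0 <= h s -> L r < L s.
Proof.
move=> r0 rs hs.
apply: (@derive_gt0_lt R L (fun x => h x * E x) _ _ rs); first exact: rp_cL P.
move=> x /andP[rx xs]; have x0 : 0 < x by exact: le_lt_trans rx.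
split; first exact: rp_dL P _ _.
rewrite mulr_gt0 ?(rp_E0 P)//; apply: (le_lt_trans hs).
by rewrite (rp_h_lt P)// ltW.
Qed.

Lemma rp_L_decr r s : 0 <= r -> r < s -> h r <= 0 -> L s < L r.
Proof.
move=> r0 rs hr; rewrite -ltrN2.
apply: (@derive_gt0_lt R (- L) (fun x => - (h x * E x)) _ _ rs).
  by move=> x; apply: continuousN; exact: rp_cL P _.
move=> x /andP[rx xs]; have x0 : 0 < x by exact: le_lt_trans rx.
have ? := rp_dL P x0; split; first exact: is_deriveN.
rewrite oppr_gt0 pmulr_llt0 ?(rp_E0 P)//; apply: lt_le_trans hr.
by rewrite (rp_h_lt P).
Qed.

(** Otherwise [h] stays positive and [L] above [L 1], against
    [rp_L_not_bounded_below]. *)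
Lemma rp_turning_point : exists2 r, 0 < r & h r = 0.
Proof.
have [r r0 hr] : exists2 r, 0 < r & h r <= 0.
  apply: contrapT => noh.
  apply: (@rp_L_not_bounded_below _ _ _ _ _ _ _ P 1 (L 1)) => //.
    exact: rp_L_gt0 P _ _.
  move=> s; rewrite le_eqVlt => /predU1P[->//|s1]; rewrite ltW// rp_L_incr//.
  rewrite leNgt; apply/negP => hs; apply: noh; exists s; last exact: ltW.
  by apply: lt_trans s1.
have [||s /[!in_itv]/= /andP[s0 sr] hs] := IVT (f := h) (v := 0) (ltW r0).
- by apply: continuous_subspaceT; exact: rp_ch P.
- by rewrite (rp_h0 P) ge_min le_max hr orbT ler01.
exists s => //; rewrite lt_neqAle s0 andbT; apply/negP => /eqP s0'.
by move: hs; rewrite -s0' (rp_h0 P) => /eqP; rewrite oner_eq0.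
Qed.

(** [L] drops below [e] by [rp_L_not_bounded_below] and decreases from [r] on. *)
Lemma rp_L_small r e : 0 < r -> h r <= 0 -> 0 < e ->
  exists2 s, r <= s & forall t, s <= t -> L t < e.
Proof.
move=> r0 hr e0.
have [s rs Ls] : exists2 s, r <= s & L s < e.
  apply: contrapT => noL.
  apply: (rp_L_not_bounded_below P r0 e0) => s rs.
  by rewrite leNgt; apply/negP => Ls; apply: noL; exists s.
exists s => // t; rewrite le_eqVlt => /predU1P[<-//|st].
apply: lt_trans Ls; apply: rp_L_decr => //; first by rewrite ltW ?(lt_le_trans r0).
apply: le_trans hr; move: rs; rewrite le_eqVlt => /predU1P[->//|rs].
by rewrite ltW// (rp_h_lt P)// ltW.
Qed.

Lemma rp_L_cvg0 : L r @[r --> +oo] --> 0.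
Proof.
apply/cvgrPdist_lt => e e0.
have [r r0 hr] := rp_turning_point.
have [|s rs sL] := rp_L_small r0 _ e0; first by rewrite hr.
near=> t.
have st : s <= t by near: t; apply: nbhs_pinfty_ge; rewrite num_real.
have t0 : 0 < t by apply: (lt_le_trans r0); exact: le_trans st.
by rewrite sub0r normrN gtr0_norm ?(rp_L_gt0 P)// sL.
Unshelve. all: by end_near. Qed.

Lemma rp_L_le1 r : 0 <= r -> L r <= 1.
Proof.
rewrite le_eqVlt => /predU1P[<-|r0]; first by rewrite (rp_L0 P) ler01.
have L0 := rp_L_gt0 P r0; rewrite -(@ler_pXn2r _ 2) ?nnegrE ?ler01 ?(ltW L0)//.
by have := rp_isoperimetric P (ltW r0); have := sqr_ge0 (1 - a r); rewrite !expr2; lra.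
Qed.

Variable aoo : R.
Hypothesis a_le : forall r : R, 0 < r -> a r <= aoo.
Hypothesis a_sup : forall e : R, 0 < e -> exists2 r : R, 0 < r & aoo - e < a r.

Lemma rp_a_sup_ge r e : 0 < r -> 0 < e -> exists2 s, r <= s & aoo - e < a s.
Proof.
move=> r0 /a_sup[s s0 es]; have [rs|sr] := leP r s; first by exists s.
by exists r => //; apply: lt_trans es _; rewrite (rp_a_lt P)// ltW.
Qed.

Lemma rp_aoo_gt0 : 0 < aoo.
Proof. exact: lt_le_trans (rp_a_gt0 P ltr01) (a_le ltr01). Qed.

(** [F = L^2 - a (aoo - a)] has derivative [L E (2 (h + a) - aoo)], whose last
    factor is nonincreasing.  Where it is nonnegative, [F] has only increased
    since the origin; where it is negative, [F] only decreases from there on,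
    while [F >= - a (aoo - a)] tends to [0]. *)
Lemma rp_reverse_isoperimetric r : 0 < r -> a r * (aoo - a r) <= L r ^+ 2.
Proof.
move=> r0; pose F : R -> R := L * L - a * (cst aoo - a).
pose dF x := L x * E x * (2 * (h x + a x) - aoo).
have FE x : F x = L x * L x - a x * (aoo - a x) by [].
have cF : continuous F.
  move=> x; apply: continuousB; first by apply: continuousM; exact: rp_cL P _.
  apply: continuousM; first exact: rp_ca P _.
  by apply: continuousB; [exact: cvg_cst|exact: rp_ca P _].
have dFE (x : R) : 0 < x -> is_derive x 1 F (dF x).
  move=> x0; have ? := rp_da P x0; have ? := rp_dL P x0; rewrite /F.
  apply: is_derive_eq; rewrite /GRing.scale/= /dF.
  by rewrite -![(cst aoo - a) _]/(aoo - a _); ring.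
rewrite expr2 -subr_ge0 -FE.
have LE0 x : 0 < x -> 0 <= L x * E x.
  by move=> x0; rewrite mulr_ge0 ?(ltW (rp_L_gt0 P _)) ?(ltW (rp_E0 P _)).
have [Gr|Gr] := leP 0 (2 * (h r + a r) - aoo).
  have -> : 0 = F 0 by rewrite FE (rp_L0 P) (rp_a0 P); ring.
  apply: (derive_ge0_le (ltW r0) cF) => x /andP[x0 xr]; split; first exact: dFE.
  rewrite mulr_ge0 ?LE0//; apply: (le_trans Gr).
  by have := rp_ha_le P (ltW x0) (ltW xr); lra.
apply/ler_addgt0Pr => e e0.
have [s rs es] := rp_a_sup_ge r0 (divr_gt0 e0 rp_aoo_gt0).
have s0 : 0 < s by exact: lt_le_trans rs.
have : - F r <= - F s.
  apply: (derive_ge0_le_cc (F := - F) (dF := - dF) rs) => x /andP[rx xs].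
  have x0 : 0 < x by exact: lt_le_trans rx.
  split; first by have ? := dFE x x0; exact: is_deriveN.
  rewrite -[(- dF) x]/(- dF x) oppr_ge0 mulr_ge0_le0 ?LE0//.
  by have := rp_ha_le P (ltW r0) rx; lra.
have : a s * (aoo - a s) <= e.
  have as0 := rp_a_gt0 P s0; have asoo := a_le s0.
  apply: (@le_trans _ _ (aoo * (e / aoo))).
    by apply: ler_pM; rewrite ?subr_ge0 ?(ltW as0)//; lra.
  by rewrite mulrC divfK// gt_eqF// rp_aoo_gt0.
have := sqr_ge0 (L s); rewrite expr2.
by rewrite lerN2 (FE s); lra.
Qed.

(** Let the larger radius in [rp_cap_ratio] tend to infinity and bound the full
    cap by [2]. *)
Lemma rp_aoo_cap r : 0 < r -> aoo * (1 - cos (T r)) <= 2 * a r.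
Proof.
move=> r0; have c1 := rp_cos_lt1 P r0.
apply/ler_addgt0Pr => e e0.
have [|s rs es] := @rp_a_sup_ge r (e / (1 - cos (T r))) r0.
  by rewrite divr_gt0// subr_gt0.
have : (aoo - e / (1 - cos (T r))) * (1 - cos (T r)) <= a s * (1 - cos (T r)).
  by rewrite ler_wpM2r ?ltW// subr_gt0.
have := rp_cap_ratio P r0 rs.
have : a r * (1 - cos (T s)) <= a r * 2.
  by rewrite ler_wpM2l ?(ltW (rp_a_gt0 P _))//; have := cos_geN1 (T s); lra.
by rewrite mulrBl divfK; [lra|rewrite subr_eq0 gt_eqF].
Qed.

End profile_end.

(** * The Laplacian of a radial function *)

Section partial.
Variable R : realType.
Implicit Types F : R * R -> R.

(** Partial derivatives as derivatives of partial functions: the difference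
    quotients coincide. *)
Lemma is_derive_e1 F (x y d : R) :
  is_derive (x, y) e1 F d <-> is_derive x 1 (fun t => F (t, y)) d.
Proof.
have quo : (fun h : R => h^-1 *: ((F \o shift (x, y)) (h *: e1) - F (x, y))) =
    (fun h : R => h^-1 *: (((fun t => F (t, y)) \o shift x) (h *: (1 : R)) - F (x, y))).
  apply/funext => h /=; congr (_ *: (F _ - _)); congr pair.
  by rewrite /e1 /= scaler0 add0r.
split=> -[dF DF]; (apply: DeriveDef; first by move: dF; rewrite /derivable quo).
  by rewrite -DF /derive quo.
by rewrite -DF /derive quo.
Qed.

Lemma is_derive_e2 F (x y d : R) :
  is_derive (x, y) e2 F d <-> is_derive y 1 (fun t => F (x, t)) d.
Proof.
have quo : (fun h : R => h^-1 *: ((F \o shift (x, y)) (h *: e2) - F (x, y))) =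
    (fun h : R => h^-1 *: (((fun t => F (x, t)) \o shift y) (h *: (1 : R)) - F (x, y))).
  apply/funext => h /=; congr (_ *: (F _ - _)); congr pair.
  by rewrite /e2 /= scaler0 add0r.
split=> -[dF DF]; (apply: DeriveDef; first by move: dF; rewrite /derivable quo).
  by rewrite -DF /derive quo.
by rewrite -DF /derive quo.
Qed.

Lemma enorm_axis (r : R) : 0 <= r -> enorm (r, 0) = r.
Proof. by move=> r0; rewrite /enorm /= expr0n addr0 sqrtr_sqr ger0_norm. Qed.

Lemma enorm_ge0 (p : R * R) : 0 <= enorm p.
Proof. exact: sqrtr_ge0. Qed.

Lemma enorm_polar (r t : R) : 0 <= r -> enorm (r * cos t, r * sin t) = r.
Proof.
move=> r0; rewrite /enorm/= !exprMn -mulrDr cos2Dsin2 mulr1 sqrtr_sqr.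
by rewrite ger0_norm.
Qed.

End partial.

Section radial.
Variables (R : realType) (u : R * R -> R).
Hypothesis u_smooth : smooth u.
Hypothesis u_radial : radially_symmetric u.

Definition radial_part (r : R) : R := u (r, 0).
Definition radial_part1 (r : R) : R := 'D_e1 u (r, 0).
Definition radial_part2 (r : R) : R := 'D_e1 ('D_e1 u) (r, 0).

Lemma radialE p : u p = radial_part (enorm p).
Proof. by apply: u_radial; rewrite enorm_axis// enorm_ge0. Qed.

Lemma u_continuous : continuous u.
Proof. by case: (u_smooth 0). Qed.

Lemma is_derive_radial_part (r : R) :
  is_derive r 1 radial_part (radial_part1 r).
Proof.
have [_ [D1 _ _ _]] := u_smooth 1.
exact: (proj1 (@is_derive_e1 R u r 0 (radial_part1 r)) (derivableP (D1 _))).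
Qed.

Lemma is_derive_radial_part1 (r : R) :
  is_derive r 1 radial_part1 (radial_part2 r).
Proof.
have [_ [_ _ [_ [D1 _ _ _]] _]] := u_smooth 2.
exact: (proj1 (@is_derive_e1 R _ r 0 (radial_part2 r)) (derivableP (D1 _))).
Qed.

Lemma continuous_radial_part : continuous radial_part.
Proof.
move=> x; apply/differentiable_continuous/derivable1_diffP.
by have ? := is_derive_radial_part x; exact: ex_derive.
Qed.

Lemma continuous_radial_part1 : continuous radial_part1.
Proof.
move=> x; apply/differentiable_continuous/derivable1_diffP.
by have ? := is_derive_radial_part1 x; exact: ex_derive.
Qed.

(** The second term comes from the [e2] direction: [u (r, y)] is the radial part
    at [rho y], the distance of [(r, y)] from the origin, with derivative
    [radial_part1 (rho y) * y / rho y], a multiple of [y]. *)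
Lemma laplacian_radial (r : R) : 0 < r ->
  laplacian u (r, 0) = radial_part2 r + radial_part1 r / r.
Proof.
move=> r0; congr (_ + _).
pose rho (y : R) := Num.sqrt (r ^+ 2 + y ^+ 2).
have q0 y : 0 < r ^+ 2 + y ^+ 2 by rewrite ltr_wpDr ?sqr_ge0// exprn_gt0.
have rho0 y : rho y != 0 by rewrite gt_eqF// sqrtr_gt0.
have drho (y : R) : is_derive y 1 rho (y / rho y).
  pose q : R -> R := cst (r ^+ 2) + id * id.
  have dq : is_derive y 1 q (2 * y).
    have dd := is_deriveD (is_derive_cst (r ^+ 2) y (1 : R))
      (is_deriveM (is_derive_id y (1 : R)) (is_derive_id y (1 : R))).
    apply: is_derive_eq; rewrite /GRing.scale/=; ring.
  have -> : rho = Num.sqrt \o q by apply/funext => x; rewrite /rho expr2.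
  have -> : y / (Num.sqrt \o q) y = (2 * Num.sqrt (q y))^-1 * (2 * y).
    have : Num.sqrt (q y) != 0 by have := rho0 y; rewrite /rho expr2.
    by move=> /= ?; field.
  apply: is_derive1_comp dq; apply: is_derive1_sqrt.
  by have := q0 y; rewrite [y ^+ 2]expr2.
have uE (y : R) : is_derive y 1 (fun t => u (r, t)) (radial_part1 (rho y) * (y / rho y)).
  rewrite (_ : (fun t => _) = radial_part \o rho); last first.
    by apply/funext => t; rewrite /= radialE.
  by have ? := is_derive_radial_part (rho y); exact: is_derive1_comp.
have D2E (y : R) : 'D_e2 u (r, y) = radial_part1 (rho y) / rho y * y.
  have ? := proj2 (@is_derive_e2 R u r y _) (uE y).
  by rewrite derive_val mulrA mulrAC.
have rhor : rho 0 = r by rewrite /rho expr0n addr0 sqrtr_sqr gtr0_norm.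
have : is_derive (0:R) 1 (fun t => 'D_e2 u (r, t)) (radial_part1 r / r).
  rewrite (_ : (fun t => _) = (fun t => radial_part1 (rho t) / rho t) * (@id R)); last first.
    by apply/funext => t; rewrite D2E.
  have ? := is_derive_radial_part1 (rho 0).
  have ? := is_derive_div (rho0 0) (is_derive1_comp (f := radial_part1) _ (drho 0)) (drho 0).
  apply: is_derive_eq; rewrite /GRing.scale/= rhor mul0r addr0 mulr1 //.
by move=> d2; have ? := proj2 (@is_derive_e2 R ('D_e2 u) r 0 _) d2; rewrite derive_val.
Qed.

End radial.

(** * Area of Euclidean disks *)

Section disk.
Variable R : realType.
Local Notation leb := (@lebesgue_measure R).

Lemma measurable_enorm : measurable_fun [set: R * R] (@enorm R).
Proof.
rewrite (_ : @enorm R = Num.sqrt \o (fun p : R * R => p.1 ^+ 2 + p.2 ^+ 2))//.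
apply: measurableT_comp.
  apply: continuous_measurable_fun; exact: sqrt_continuous.
by apply: measurable_funD; apply: measurable_funX;
  [exact: measurable_fst|exact: measurable_snd].
Qed.

Lemma measurable_edisk (r : R) : measurable (edisk r).
Proof.
have := measurable_enorm measurableT (measurable_itv `]-oo, r[).
by rewrite setTI; congr (measurable _); apply/seteqP; split => p /=; rewrite in_itv.
Qed.

Lemma edisk_le0 (r : R) : r <= 0 -> edisk r = set0.
Proof.
move=> r0; apply/seteqP; split => p //= /(le_lt_trans (enorm_ge0 p)).
by rewrite /= ltNge r0.
Qed.

(** Valid for every [x], also outside the disk: there the square root is [0] and
    the interval is empty. *)
Lemma xsection_edisk (r x : R) :
  xsection (edisk r) x = if 0 < r then
    `]- Num.sqrt (r ^+ 2 - x ^+ 2), Num.sqrt (r ^+ 2 - x ^+ 2)[%classic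
    else set0.
Proof.
case: ifPn => [r0|]; last by rewrite -leNgt => /edisk_le0 ->; rewrite xsection0.
apply/seteqP; split => y; rewrite /xsection/= inE /edisk/= in_itv/= /enorm/=.
  rewrite -ltr_norml -sqrtr_sqr => xy.
  have : x ^+ 2 + y ^+ 2 < r ^+ 2.
    rewrite -ltr_sqrt ?exprn_gt0// (lt_le_trans xy)//.
    by rewrite sqrtr_sqr ler_norm.
  move=> {}xy; rewrite ltr_sqrt; first by rewrite ltrBrDl.
  by rewrite subr_gt0 (le_lt_trans _ xy)// lerDl sqr_ge0.
rewrite -ltr_norml -sqrtr_sqr => xy.
have r2 : 0 < r ^+ 2 - x ^+ 2.
  by rewrite ltNge; apply/negP => /ler0_sqrtr q; move: xy; rewrite q ltNge sqrtr_ge0.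
move: xy; rewrite ltr_sqrt// ltrBrDl => xy.
have -> : r = Num.sqrt (r ^+ 2) by rewrite sqrtr_sqr gtr0_norm.
by rewrite ltr_sqrt// exprn_gt0.
Qed.

Lemma is_derive_LRcontinuous (F dF : R -> R) (a b : R) :
  (forall x : R, is_derive x 1 F (dF x)) -> derivable_oo_LRcontinuous F a b.
Proof.
move=> H; have cF : continuous F.
  move=> t; apply/differentiable_continuous/derivable1_diffP.
  by have ? := H t; exact: ex_derive.
split => [x _||].
- by have ? := H x; exact: ex_derive.
- by apply: cvg_at_right_filter; exact: cF.
- by apply: cvg_at_left_filter; exact: cF.
Qed.

(** Substitution [x = r sin t]. *)
Lemma integral_half_disk (r : R) : 0 < r ->
  (\int[leb]_(x in `[(- r)%R, r]) (2 * Num.sqrt (r ^+ 2 - x ^+ 2))%R%:E =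
   (pi * r ^+ 2)%R%:E)%E.
Proof.
move=> r0.
pose F (t : R) : R := r * sin t.
have dF (t : R) : is_derive t 1 F (r * cos t).
  by have := is_deriveZ r (is_derive_sin t).
have F'E : F^`()%classic = fun t => r * cos t.
  by apply/funext => t; rewrite derive1E; have ? := dF t; rewrite derive_val.
have cont_F : continuous F.
  by move=> t; apply: continuousM; [exact: cvg_cst|exact: continuous_sin].
have cont_F' : continuous F^`()%classic.
  by rewrite F'E => t; apply: continuousM; [exact: cvg_cst|exact: continuous_cos].
have Fl : F (- (pi / 2)) = - r by rewrite /F sinN sin_pihalf mulrN1.
have Fr : F (pi / 2) = r by rewrite /F sin_pihalf mulr1.
have pi0 := @pi_gt0 R.
have contq : continuous (fun x : R => 2 * Num.sqrt (r ^+ 2 - x ^+ 2)).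
  move=> t; have cq : {for t, continuous (fun x : R => r ^+ 2 - x * x)}.
    by apply: continuousB; [exact: cvg_cst|apply: continuousM].
  have cs := continuous_comp cq (@sqrt_continuous R _).
  by have := continuousM (@cst_continuous _ _ (2 : R) t) cs.
have pipi : - (pi / 2) < pi / 2 :> R by lra.
pose G (t : R) : R := r ^+ 2 * (t + sin t * cos t).
have dG (t : R) : is_derive t 1 G (2 * r ^+ 2 * cos t ^+ 2).
  have dd := is_deriveZ (r ^+ 2) (is_deriveD (is_derive_id t 1)
    (is_deriveM (is_derive_sin t) (is_derive_cos t))).
  apply: is_derive_eq; rewrite /GRing.scale/=.
  by rewrite -[X in _ * (X + _)](cos2Dsin2 t); ring.
rewrite -[X in `[X, _]]Fl -[X in `[_, X]]Fr integration_by_substitution_increasing ?(ltW pipi)//.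
- transitivity (\int[leb]_(t in `[(- (pi / 2))%R, (pi / 2)%R])
      (2 * r ^+ 2 * cos t ^+ 2)%R%:E)%E.
    apply: eq_integral => t; rewrite inE/= in_itv/= => /cos_ge0_pihalf ct.
    rewrite -[((_ \o F) * F^`()%classic) t]/(2 * Num.sqrt (r ^+ 2 - F t ^+ 2) * F^`()%classic t).
    rewrite F'E /F exprMn -{1}(mulr1 (r ^+ 2)) -mulrBr -cos2sin2 -exprMn.
    by rewrite sqrtr_sqr ger0_norm ?mulr_ge0 ?(ltW r0)//; congr EFin; ring.
  have contg : continuous (fun t : R => 2 * r ^+ 2 * cos t ^+ 2).
    move=> t; have cc := @continuous_cos R t.
    by have := continuousM (@cst_continuous _ _ (2 * r ^+ 2 : R) t) (continuousM cc cc).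
  rewrite (continuous_FTC2 (F := G) pipi (continuous_subspaceT contg)).
  + rewrite -EFinB /G sinN cosN sin_pihalf cos_pihalf; congr EFin; by field.
  + exact: is_derive_LRcontinuous dG.
  + by move=> t _; rewrite derive1E; have ? := dG t; rewrite derive_val.
- move=> x y xpi ypi xy; rewrite /F ltr_pM2l// ltr_sin//.
- by apply/cvg_ex; eexists; apply: cvg_at_right_filter; exact: cont_F'.
- by apply/cvg_ex; eexists; apply: cvg_at_left_filter; exact: cont_F'.
- exact: is_derive_LRcontinuous dF.
- exact: continuous_subspaceT.
Qed.

Lemma edisk_measure (r : R) : 0 <= r ->
  ((leb \x leb) (edisk r) = (pi * r ^+ 2)%:E)%E.
Proof.
rewrite le_eqVlt => /predU1P[<-|r0].
  by rewrite edisk_le0// measure0 expr0n mulr0.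
rewrite -integral_half_disk// /product_measure1 /= [RHS]integral_mkcond.
apply: eq_integral => x _; rewrite xsection_edisk r0 patchE.
rewrite lebesgue_measure_itv/= lte_fin.
case: ifPn => [s0|s0].
  have -> : x \in `[(- r), r]%classic.
    rewrite inE/= in_itv/= -ler_norml.
    have : 0 < Num.sqrt (r ^+ 2 - x ^+ 2) by lra.
    rewrite sqrtr_gt0 subr_gt0 => xr.
    rewrite -(gtr0_norm r0) -!sqrtr_sqr ler_sqrt ?sqr_ge0// ltW//.
  by rewrite -EFinD; congr EFin; lra.
have := sqrtr_ge0 (r ^+ 2 - x ^+ 2) => q0.
have -> : Num.sqrt (r ^+ 2 - x ^+ 2) = 0 by move: s0; rewrite -leNgt; lra.
by case: ifP; rewrite ?mulr0.
Qed.

End disk.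

(** * Conformal area as a function of the radius *)

Section area.
Variables (R : realType) (u : R * R -> R).
Hypothesis u_smooth : smooth u.
Hypothesis u_radial : radially_symmetric u.
Local Notation leb := (@lebesgue_measure R).
Local Notation f := (radial_part u).

Definition radial_density (r : R) : R := expR (2 * f r).
Local Notation W := radial_density.

Lemma density_radial p : expR (2 * u p) = W (enorm p).
Proof. by rewrite (radialE u_radial). Qed.

Lemma continuous_radial_density : continuous W.
Proof.
move=> t; have cf := continuousM (@cst_continuous _ _ (2 : R) t)
  (@continuous_radial_part R u u_smooth t).
exact: (continuous_comp cf (@continuous_expR R _)).
Qed.

Lemma measurable_density D : measurable_fun D (fun p : R * R => (expR (2 * u p))%:E).
Proof.
apply: (measurable_funS measurableT) => //; apply/measurable_EFinP.
rewrite (_ : (fun p => _) = W \o @enorm R); last first.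
  by apply/funext => p; rewrite /= density_radial.
apply: measurableT_comp; last exact: measurable_enorm.
by apply: continuous_measurable_fun; exact: continuous_radial_density.
Qed.

Lemma annulus_measure (r s : R) : 0 <= r -> r <= s ->
  ((leb \x leb) (edisk s `\` edisk r) = (pi * (s ^+ 2 - r ^+ 2))%:E)%E.
Proof.
move=> r0 rs; have s0 := le_trans r0 rs.
have rsub : edisk r `<=` edisk s by move=> p /= /lt_le_trans; apply.
have mr := @measurable_edisk R r; have ms := @measurable_edisk R s.
transitivity ((leb \x leb) (edisk s) - (leb \x leb) (edisk s `&` edisk r))%E.
  apply: measureD => //.
  by have := ltry (pi * s ^+ 2); rewrite -(edisk_measure s0).
by rewrite setIidr// !edisk_measure// -EFinB mulrBr.
Qed.

(** The equality is between extended reals while [X] is real, so that finiteness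
    of the area of the large disk reduces to that of the small one. *)
Lemma garea_annulus (r s m M : R) : 0 <= r -> r <= s ->
  (forall x, r <= x <= s -> m <= W x <= M) ->
  exists X : R, garea u (edisk s) = (garea u (edisk r) + X%:E)%E /\
    m * (pi * (s ^+ 2 - r ^+ 2)) <= X <= M * (pi * (s ^+ 2 - r ^+ 2)).
Proof.
move=> r0 rs WmM.
have rsub : edisk r `<=` edisk s by move=> p /= /lt_le_trans; apply.
have mr := @measurable_edisk R r; have ms := @measurable_edisk R s.
have mD : measurable (edisk s `\` edisk r) by exact: measurableD.
have Ie : garea u (edisk s) =
    (garea u (edisk r) + garea u (edisk s `\` edisk r))%E.
  rewrite /garea -{1}(setDUK rsub) ge0_integral_setU//.
  - exact: measurable_density.
  - by apply/disj_set2P/seteqP; split => p // [? []].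
have mM p : (edisk s `\` edisk r) p -> m <= expR (2 * u p) <= M.
  move=> [/= ps /negP]; rewrite -leNgt => rp; rewrite density_radial; apply: WmM.
  by rewrite rp ltW.
have up : (garea u (edisk s `\` edisk r) <= (M * (pi * (s ^+ 2 - r ^+ 2)))%:E)%E.
  rewrite EFinM -annulus_measure// -integral_cst//.
  apply: ge0_le_integral => //.
  - exact: measurable_density.
  - by move=> p /mM/andP[_ pM]; rewrite lee_fin.
have lo : ((m * (pi * (s ^+ 2 - r ^+ 2)))%:E <= garea u (edisk s `\` edisk r))%E.
  (* The comparison of integrals is for nonnegative functions. *)
  apply: (@le_trans _ _ ((Num.max 0 m) * (pi * (s ^+ 2 - r ^+ 2)))%:E).
    rewrite lee_fin ler_wpM2r ?le_max ?lexx ?orbT// mulr_ge0 ?pi_ge0// subr_ge0.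
    by rewrite lerXn2r ?nnegrE// (le_trans r0).
  rewrite EFinM -annulus_measure// -integral_cst//.
  apply: ge0_le_integral => //.
  - by move=> p _; rewrite lee_fin le_max lexx.
  - exact: measurable_density.
  - by move=> p /mM/andP[mp _]; rewrite lee_fin ge_max expR_ge0.
exists (fine (garea u (edisk s `\` edisk r))).
have fin : garea u (edisk s `\` edisk r) \is a fin_num.
  rewrite fin_numE; apply/andP; split; apply/eqP => E.
    by move: lo; rewrite E.
  by move: up; rewrite E.
by rewrite fineK//; split=> //; rewrite -!lee_fin fineK// lo up.
Qed.

Lemma disk_area_le0 r : r <= 0 -> disk_area u r = 0.
Proof. by move=> r0; rewrite /disk_area edisk_le0// /garea integral_set0. Qed.

Lemma density_bounded r : exists M : R, forall x, 0 <= x <= r -> W x <= M.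
Proof.
have [r0|r0] := leP 0 r; last by exists 0 => x /andP[x0 /(le_trans x0)]; rewrite leNgt r0.
have [c _ cM] := EVT_max r0 (continuous_subspaceT continuous_radial_density).
by exists (W c) => x xr; apply: cM; rewrite in_itv.
Qed.

Lemma garea_disk_fin r : garea u (edisk r) \is a fin_num.
Proof.
have [r0|r0] := leP r 0; first by rewrite edisk_le0// /garea integral_set0.
have [M WM] := density_bounded r.
have [|X [-> _]] := @garea_annulus 0 r 0 M (lexx _) (ltW r0).
  by move=> x /WM ->; rewrite expR_ge0.
by rewrite edisk_le0// /garea integral_set0 add0e.
Qed.

Lemma disk_areaE r : garea u (edisk r) = (disk_area u r)%:E.
Proof. by rewrite fineK// garea_disk_fin. Qed.

Lemma disk_area_annulus (r s m M : R) : 0 <= r -> r <= s ->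
  (forall x, r <= x <= s -> m <= W x <= M) ->
  m * (pi * (s ^+ 2 - r ^+ 2)) <= disk_area u s - disk_area u r
    <= M * (pi * (s ^+ 2 - r ^+ 2)).
Proof.
move=> r0 rs /(garea_annulus r0 rs)[X [E XmM]].
rewrite [disk_area u s]/disk_area E disk_areaE -EFinD /=.
by rewrite [_ + X]addrC addrK.
Qed.

(** Caratheodory's criterion: [disk_area u s - disk_area u r] is the Euclidean
    annulus area [pi (s - r) (s + r)] times a mean density, and the mean density
    is continuous at [r] because it lies between the extrema of the density. *)
Lemma is_derive_disk_area (r : R) : 0 < r ->
  is_derive r 1 (disk_area u) (2 * pi * r * W r).
Proof.
move=> r0.
(* The mean density of the annulus between [r] and [s], on either side. *)
pose theta s := if s == r then W r
  else (disk_area u s - disk_area u r) / (pi * (s ^+ 2 - r ^+ 2)).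
have pi0 := @pi_gt0 R.
have dq s : 0 < s -> s != r -> s ^+ 2 - r ^+ 2 != 0.
  move=> s0 sr; rewrite subr_sqr mulf_neq0 ?subr_eq0// gt_eqF// addr_gt0//.
have theta_mM s m M : 0 < s -> 
    (forall x, Num.min r s <= x <= Num.max r s -> m <= W x <= M) -> m <= theta s <= M.
  move=> s0 WmM; rewrite /theta; case: eqVneq => [_|sr].
    by apply: WmM; rewrite ge_min le_max lexx.
  have [rs|sr'] := leP r s.
    have q0 : 0 < pi * (s ^+ 2 - r ^+ 2).
      by rewrite mulr_gt0// subr_gt0 ltrXn2r// ?nnegrE ?ltW// lt_neqAle eq_sym sr.
    rewrite ler_pdivlMr// ler_pdivrMr//; apply: disk_area_annulus => //; first exact: ltW.
    by move=> x xrs; apply: WmM; rewrite min_l// max_r.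
  have q0 : 0 < pi * (r ^+ 2 - s ^+ 2).
    by rewrite mulr_gt0// subr_gt0 ltrXn2r// ?nnegrE ltW.
  rewrite -opprB -[s ^+ 2 - r ^+ 2]opprB mulrN invrN mulrNN.
  rewrite ler_pdivlMr// ler_pdivrMr//; apply: disk_area_annulus => //; try exact: ltW.
  by move=> x xrs; apply: WmM; rewrite min_r ?max_l// ltW.
have ctheta : {for r, continuous theta}.
  apply/cvgrPdist_le => e e0.
  have /cvgrPdist_le/(_ e e0)[d /= d0 dW] := @continuous_radial_density r.
  near=> s.
  have s0 : 0 < s by near: s; exact: lt_nbhsr.
  have sd : `|r - s| < d by near: s; exists d.
  rewrite {1}/theta eqxx ler_distlC; apply: theta_mM => // x xrs.
  rewrite -ler_distlC; apply: dW => /=; apply: le_lt_trans sd.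
  move: xrs; have [rs|/ltW sr] := leP r s.
    move=> /andP[rx xs].
    by rewrite !ler0_norm ?subr_le0//; lra.
  move=> /andP[sx xr].
  by rewrite !ger0_norm ?subr_ge0//; lra.
(* For [s <= 0] the bounds on [theta] are not available, but any factor that
   satisfies the equation will do away from [r]. *)
apply/is_derive1_caratheodory; exists (fun s => if 0 < s then theta s * (pi * (s + r))
   else (disk_area u s - disk_area u r) / (s - r)); split.
- move=> s; case: ifPn => s0; last first.
    rewrite divfK// subr_eq0 lt_eqF// (le_lt_trans _ r0)// leNgt//.
  rewrite /theta; case: eqVneq => [->|sr]; first by rewrite !subrr mulr0.
  rewrite -mulrA -[_ * (s + r) * _]mulrA [(s + r) * _]mulrC -subr_sqr divfK//.
  by rewrite mulf_neq0 ?dq// gt_eqF.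
- have cc : {for r, continuous (fun s : R => theta s * (pi * (s + r)))}.
    apply: continuousM => //; apply: continuousM; first exact: cvg_cst.
    by apply: continuousD => //; exact: cvg_cst.
  rewrite /prop_for/continuous_at r0; apply: cvg_trans cc.
  apply: near_eq_cvg; near=> s.
  by have -> : 0 < s by near: s; exact: lt_nbhsr.
- by rewrite r0 /theta eqxx; ring.
Unshelve. all: by end_near. Qed.

(** At the origin the area is squeezed between [0] and [M pi s^2]. *)
Lemma continuous_disk_area : continuous (disk_area u).
Proof.
move=> r; have [r0|r0|->] := ltgtP r 0.
- rewrite /continuous_at disk_area_le0 ?ltW//; apply: cvg_near_cst.
  near=> s; apply: disk_area_le0; apply: ltW.
  by near: s; exact: lt_nbhsl.
- apply/differentiable_continuous/derivable1_diffP.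
  by have ? := is_derive_disk_area r0; exact: ex_derive.
- have [M WM] := density_bounded 1.
  have M0 : 0 <= M by apply: le_trans (WM 0 _); rewrite ?expR_ge0// lexx ler01.
  rewrite /continuous_at disk_area_le0//.
  apply: (@squeeze_cvgr _ _ _ _ (cst 0) (fun s => M * (pi * (s * s)))).
  + near=> s.
    have [s0|s0] := leP s 0.
      by rewrite disk_area_le0// lexx /= mulr_ge0// mulr_ge0 ?pi_ge0// -expr2 sqr_ge0.
    have s1 : s < 1 by near: s; exact: lt_nbhsl ltr01.
    have := @disk_area_annulus 0 s 0 M (lexx _) (ltW s0).
    rewrite (disk_area_le0 (lexx 0)) !expr2 mul0r mulr0 !subr0; apply.
    by move=> x /andP[x0 xs]; rewrite expR_ge0 WM// x0 (le_trans xs)// ltW.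
  + exact: cvg_cst.
  + rewrite [X in _ --> X](_ : 0 = M * (pi * (0 * 0))); last by rewrite !mulr0.
    have cid : {for 0, continuous (@idfun R)} by move=> ?.
    exact: (continuousM (@cst_continuous _ _ M 0)
      (continuousM (@cst_continuous _ _ pi 0) (continuousM cid cid))).
Unshelve. all: by end_near. Qed.

End area.

(** * Polar curves, circle lengths, radial distance and total area *)

Section polar.
Variable R : realType.

Lemma is_derive_pair (a b : R -> R) (t da db : R) :
  is_derive t 1 a da -> is_derive t 1 b db ->
  is_derive t 1 (fun s => (a s, b s) : R * R) (da, db).
Proof.
move=> [a1 a2] [b1 b2].
have C : (fun h : R => h^-1 *: (((fun s => (a s, b s) : R * R) \o shift t) (h *: (1 : R))
    - (a t, b t))) @ 0^' --> ((da, db) : R * R).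
  have Ca : (fun h : R => h^-1 *: ((a \o shift t) (h *: (1 : R)) - a t)) @ 0^' --> da.
    by rewrite -a2; exact: a1.
  have Cb : (fun h : R => h^-1 *: ((b \o shift t) (h *: (1 : R)) - b t)) @ 0^' --> db.
    by rewrite -b2; exact: b1.
  exact: (cvg_pair Ca Cb).
apply: DeriveDef; first by apply/cvg_ex; exists (da, db).
by apply/cvg_lim => //; exact: norm_hausdorff.
Qed.

Definition polar (q phi : R -> R) (t : R) : R * R :=
  (q t * cos (phi t), q t * sin (phi t)).

Lemma is_derive_polar (q phi : R -> R) (t dq dphi : R) :
  is_derive t 1 q dq -> is_derive t 1 phi dphi ->
  is_derive t 1 (polar q phi)
    (dq * cos (phi t) - q t * sin (phi t) * dphi,
     dq * sin (phi t) + q t * cos (phi t) * dphi).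
Proof.
move=> Hq Hphi; apply: is_derive_pair.
- have dd := is_deriveM Hq (is_derive1_comp (is_derive_cos (phi t)) Hphi).
  by apply: is_derive_eq; rewrite /GRing.scale/=; ring.
- have dd := is_deriveM Hq (is_derive1_comp (is_derive_sin (phi t)) Hphi).
  by apply: is_derive_eq; rewrite /GRing.scale/=; ring.
Qed.

Lemma enorm_polar_speed (dq q phi dphi : R) :
  enorm (dq * cos phi - q * sin phi * dphi, dq * sin phi + q * cos phi * dphi) =
  Num.sqrt (dq ^+ 2 + (q * dphi) ^+ 2).
Proof.
rewrite /enorm/=; congr Num.sqrt.
transitivity ((dq ^+ 2 + (q * dphi) ^+ 2) * (cos phi ^+ 2 + sin phi ^+ 2)); first ring.
by rewrite cos2Dsin2 mulr1.
Qed.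

Lemma enorm_derive_polar (q phi : R -> R) (t dq dphi : R) :
  is_derive t 1 q dq -> is_derive t 1 phi dphi ->
  enorm ((polar q phi)^`()%classic t) = Num.sqrt (dq ^+ 2 + (q t * dphi) ^+ 2).
Proof.
move=> Hq Hphi; have ? := is_derive_polar Hq Hphi.
by rewrite derive1E derive_val enorm_polar_speed.
Qed.

End polar.

Section global.
Variables (R : realType) (u : R * R -> R).
Hypothesis u_smooth : smooth u.
Hypothesis u_radial : radially_symmetric u.
Local Notation leb := (@lebesgue_measure R).
Local Notation f := (radial_part u).

Lemma circle_lengthE r : 0 <= r -> circle_length u r = 2 * pi * (r * expR (f r)).
Proof.
move=> r0; rewrite /circle_length /curve_integral.
rewrite (eq_integral (cst (expR (f r) * r)%:E)); last first.
  move=> t _; rewrite /= -[circle r]/(polar (cst r) id).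
  rewrite (enorm_derive_polar (is_derive_cst _ _ _) (is_derive_id _ _)).
  rewrite expr0n/= add0r mulr1 sqrtr_sqr ger0_norm//.
  by rewrite (radialE u_radial) enorm_polar.
rewrite integral_cst//= lebesgue_measure_itv/= lte_fin mulr_gt0 ?pi_gt0//.
by rewrite -EFinB -EFinM/= subr0; ring.
Qed.

Lemma continuous_radial_exp : continuous (fun r => expR (f r)).
Proof.
move=> t; have cf := @continuous_radial_part R u u_smooth t.
exact: (continuous_comp cf (@continuous_expR R _)).
Qed.

Lemma integrable_radial_exp a b : leb.-integrable `[a, b] (EFin \o (fun r => expR (f r))).
Proof.
apply: continuous_compact_integrable; first exact: segment_compact.
exact: (continuous_subspaceT continuous_radial_exp).
Qed.

Lemma gradius_le0 r : r <= 0 -> gradius u r = 0.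
Proof.
rewrite /gradius le_eqVlt => /predU1P[->|r0]; first by rewrite set_itv1 Rintegral_set1.
by rewrite set_itv_ge ?Rintegral_set0// bnd_simp -ltNge.
Qed.

Lemma is_derive_gradius (r : R) : 0 < r -> is_derive r 1 (gradius u) (expR (f r)).
Proof.
move=> r0.
have r1 : r < r + 1 by rewrite ltrDl.
have [d dE] := continuous_FTC1_closed r1 (@integrable_radial_exp 0 (r + 1)) r0
  (@continuous_radial_exp r).
by apply: DeriveDef; [exact: d|rewrite -derive1E dE].
Qed.

Lemma continuous_gradius : continuous (gradius u).
Proof.
move=> r; have [r0|r0|->] := ltgtP r 0.
- rewrite /continuous_at gradius_le0 ?ltW//; apply: cvg_near_cst.
  near=> s; apply: gradius_le0; apply: ltW.
  by near: s; exact: lt_nbhsl.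
- apply/differentiable_continuous/derivable1_diffP.
  by have ? := is_derive_gradius r0; exact: ex_derive.
- rewrite /continuous_at gradius_le0//.
  exact: (parameterized_integral_cvg_left ltr01 (@integrable_radial_exp 0 1)).
Unshelve. all: by end_near. Qed.

Lemma cvg_disk_area : ((disk_area u n%:R)%:E @[n --> \oo] --> gvol u)%E.
Proof.
have cE : \bigcup_n edisk (n%:R : R) = [set: R * R].
  apply/seteqP; split => // p _; exists (Num.truncn (enorm p)).+1 => //=.
  by rewrite /edisk/= truncnS_gt.
rewrite /gvol /garea -cE.
under eq_fun do rewrite -(disk_areaE u_smooth u_radial).
apply: ge0_nondecreasing_set_cvg_integral => //.
- apply/nondecreasing_seqP => n; rewrite subsetEset => p /= /lt_trans; apply.
  by rewrite ltr_nat.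
- by move=> n; exact: measurable_edisk.
- by move=> n; exact: measurable_density.
Qed.

Lemma garea_le_gvol r : (garea u (edisk r) <= gvol u)%E.
Proof.
apply: ge0_subset_integral => //.
- exact: measurable_edisk.
- exact: measurable_density.
Qed.

Lemma gvol_le c : (forall r, 0 < r -> disk_area u r <= c) -> (gvol u <= c%:E)%E.
Proof.
move=> Ac; apply: (cvge_le _ cvg_disk_area); near=> n.
rewrite lee_fin Ac// ltr0n; near: n; exact: nbhs_infty_gt.
Unshelve. all: by end_near. Qed.

(** The disks of integer radii exhaust the plane. *)
Lemma disk_area_sup c : gvol u = c%:E -> forall e : R, 0 < e ->
  exists2 r : R, 0 < r & c - e < disk_area u r.
Proof.
move=> vc e e0; have := cvg_disk_area; rewrite vc => /fine_cvgP[_].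
move=> /cvgrPdist_lt/(_ e e0)[N _ NA].
exists N.+1%:R; first by rewrite ltr0n.
by have := NA N.+1 (leqnSn _); rewrite /= ltr_distlC => /andP[].
Qed.

End global.

(** * The profile of a conformal metric *)

Section profile_of_metric.
Variables (R : realType) (u : R * R -> R).
Hypothesis u_smooth : smooth u.
Hypothesis u_radial : radially_symmetric u.
Hypothesis u_ineq : forall p : R * R, laplacian u p + expR (2 * u p) <= 0.
Local Notation f := (radial_part u).
Local Notation f1 := (radial_part1 u).
Local Notation f2 := (radial_part2 u).

(** The bound on the derivative of [h] is [r] times the differential inequality
    at [(r, 0)]. *)
Lemma radial_profile_of_metric :
  radial_profile (fun r => expR (f r)) (fun r => r * expR (f r))
    (fun r => 1 + r * f1 r) (fun r => f1 r + r * f2 r)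
    (fun r => disk_area u r / (2 * pi)) (gradius u).
Proof.
have pi0 := @pi_gt0 R.
have cf := continuous_radial_exp u_smooth.
have cf1 := continuous_radial_part1 u_smooth.
have df := is_derive_radial_part u_smooth.
have df1 := is_derive_radial_part1 u_smooth.
have cid : forall t : R, {for t, continuous (@idfun R)} by move=> ? ?.
split.
- by move=> t; exact: (continuousM (cid t) (cf t)).
- by move=> t; exact: (continuousD (@cst_continuous _ _ (1 : R) t) (continuousM (cid t) (cf1 t))).
- by move=> t; exact: (continuousM (continuous_disk_area u_smooth u_radial (x := t))
    (@cst_continuous _ _ ((2 * pi)^-1 : R) t)).
- exact: continuous_gradius.
- by rewrite mul0r.
- by rewrite mul0r addr0.
- by rewrite disk_area_le0// mul0r.
- exact: gradius_le0.
- by move=> r _; exact: expR_gt0.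
- by [].
- move=> r _.
  have dd := is_deriveM (is_derive_id r (1 : R)) (is_derive1_comp (is_derive_expR (f r)) (df r)).
  by apply: is_derive_eq; rewrite /GRing.scale/=; ring.
- move=> r r0.
  have dd := is_deriveM (is_derive_disk_area u_smooth u_radial r0)
    (is_derive_cst ((2 * pi)^-1 : R) r (1 : R)).
  apply: is_derive_eq; rewrite /GRing.scale/= mulr0 add0r /radial_density.
  rewrite (_ : 2 * f r = f r + f r) ?expRD; last by ring.
  rewrite (_ : 2 * pi * r * _ = 2 * pi * (r * expR (f r) * expR (f r))); last by ring.
  by rewrite mulKf// mulf_neq0// gt_eqF.
- by move=> r r0; exact: is_derive_gradius.
- move=> r _.
  have dd := is_deriveD (is_derive_cst (1 : R) r (1 : R))
    (is_deriveM (is_derive_id r (1 : R)) (df1 r)).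
  by apply: is_derive_eq; rewrite /GRing.scale/=; ring.
- move=> r r0.
  have := u_ineq (r, 0); rewrite laplacian_radial// -[u (r, 0)]/(f r).
  rewrite (_ : 2 * f r = f r + f r) ?expRD; last by ring.
  move=> H; have := ler_wpM2l (ltW r0) H.
  rewrite mulr0 2!mulrDr mulrCA divff ?gt_eqF// mulr1; lra.
Qed.

Local Notation P := radial_profile_of_metric.

Lemma disk_areaM r : disk_area u r = 2 * pi * (disk_area u r / (2 * pi)).
Proof. by rewrite mulrC divfK// mulf_neq0// gt_eqF ?pi_gt0. Qed.

Lemma gvol_le_4pi : (gvol u <= (4 * pi)%:E)%E.
Proof.
apply: (gvol_le u_smooth u_radial) => r r0.
rewrite disk_areaM (_ : 4 * pi = 2 * pi * 2); last by ring.
by rewrite ler_pM2l ?mulr_gt0 ?pi_gt0//; exact: rp_a_le2 P _ r0.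
Qed.

Lemma gvolE : gvol u = (total_area u)%:E.
Proof.
rewrite /total_area fineK//; have := gvol_le_4pi.
have : (0 <= gvol u)%E by apply: integral_ge0 => p _; rewrite lee_fin expR_ge0.
by case: (gvol u).
Qed.

Lemma disk_area_le_total r : disk_area u r <= total_area u.
Proof.
have := garea_le_gvol u_smooth u_radial r.
by rewrite gvolE (disk_areaE u_smooth u_radial) lee_fin.
Qed.

Lemma total_area_sup (e : R) : 0 < e -> exists2 r : R, 0 < r &
  total_area u / (2 * pi) - e < disk_area u r / (2 * pi).
Proof.
move=> e0; have c0 : 0 < 2 * pi :> R by rewrite mulr_gt0 ?pi_gt0.
have [|r r0 H] := disk_area_sup u_smooth u_radial gvolE (e := e * (2 * pi)).
  by rewrite mulr_gt0.
by exists r => //; rewrite ltr_pdivlMr// mulrBl divfK// gt_eqF.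
Qed.

Lemma gradius_lt_pi r : 0 <= r -> gradius u r < pi.
Proof. exact: rp_T_lt_pi P _. Qed.

End profile_of_metric.

(** * Polar form and smooth polar curves *)

Section polar_form.
Variable R : realType.

(** The angle is [acos (x / |p|)], with a sign when [p] is in the lower half
    plane. *)
Lemma polar_form (p : R * R) : exists t : R, p = (enorm p * cos t, enorm p * sin t).
Proof.
have [p0|p0] := eqVneq (enorm p) 0.
  exists 0; rewrite p0 !mul0r.
  have : p.1 ^+ 2 + p.2 ^+ 2 <= 0 by rewrite -sqrtr_eq0 -/(enorm p) p0.
  have := sqr_ge0 p.1; have := sqr_ge0 p.2 => a b c.
  have /eqP : p.1 ^+ 2 = 0 by lra.
  have /eqP : p.2 ^+ 2 = 0 by lra.
  by rewrite !sqrf_eq0 [p]surjective_pairing => /eqP /= -> /eqP ->.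
have e0 : 0 < enorm p by rewrite lt_neqAle eq_sym p0 enorm_ge0.
have e2 : enorm p ^+ 2 = p.1 ^+ 2 + p.2 ^+ 2.
  by rewrite /enorm sqr_sqrtr// addr_ge0// sqr_ge0.
have c1 : -1 <= p.1 / enorm p <= 1.
  rewrite -ler_norml normrM normfV (gtr0_norm e0) ler_pdivrMr// mul1r.
  by rewrite -sqrtr_sqr ler_sqrt ?addr_ge0 ?sqr_ge0// lerDl sqr_ge0.
have sE : enorm p * sin (acos (p.1 / enorm p)) = `|p.2|.
  rewrite sin_acos// -{1}(gtr0_norm e0) -sqrtr_sqr -sqrtrM ?sqr_ge0//.
  rewrite mulrBr mulr1 -exprMn mulrC divfK// e2 addrAC subrr add0r.
  by rewrite sqrtr_sqr.
have cE : enorm p * cos (acos (p.1 / enorm p)) = p.1.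
  by rewrite acosK// mulrC divfK.
have [p20|p20] := leP 0 p.2.
  exists (acos (p.1 / enorm p)); rewrite cE sE ger0_norm//.
  exact: surjective_pairing.
exists (- acos (p.1 / enorm p)); rewrite cosN sinN mulrN cE sE ltr0_norm// opprK.
exact: surjective_pairing.
Qed.

End polar_form.

Section smooth_polar.
Variable R : realType.

(** A class of functions that contains the coordinates of polar curves with affine
    modulus and angle and is closed under derivation, so that these curves are
    seen to be smooth by induction on the order. *)
Definition affine_trig (w c a0 a1 b0 b1 : R) (t : R) : R :=
  (a0 + a1 * t) * cos (c + w * t) + (b0 + b1 * t) * sin (c + w * t).

Lemma is_derive_affine (a b t : R) : is_derive t 1 (fun s => a + b * s) b.
Proof.
have dd := is_deriveD (is_derive_cst a t (1 : R)) (is_deriveZ b (is_derive_id t (1 : R))).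
by apply: is_derive_eq; rewrite /GRing.scale/=; ring.
Qed.

Lemma is_derive_affine_trig (w c a0 a1 b0 b1 t : R) :
  is_derive t 1 (affine_trig w c a0 a1 b0 b1)
    (affine_trig w c (a1 + w * b0) (w * b1) (b1 - w * a0) (- (w * a1)) t).
Proof.
have dw := is_derive_affine c w t.
have dd := is_deriveD
  (is_deriveM (is_derive_affine a0 a1 t)
    (is_derive1_comp (g := fun s => c + w * s) (is_derive_cos (c + w * t)) dw))
  (is_deriveM (is_derive_affine b0 b1 t)
    (is_derive1_comp (g := fun s => c + w * s) (is_derive_sin (c + w * t)) dw)).
by apply: is_derive_eq; rewrite /GRing.scale/= /affine_trig; ring.
Qed.

Lemma smooth_polar_affine (a b c w : R) :
  smooth_curve (polar (fun t => a + b * t) (fun t => c + w * t)).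
Proof.
pose pair (x : R * R * R * R) (y : R * R * R * R) (t : R) : R * R :=
  (affine_trig w c x.1.1.1 x.1.1.2 x.1.2 x.2 t,
   affine_trig w c y.1.1.1 y.1.1.2 y.1.2 y.2 t).
have dpair x y t : derivable (pair x y) t 1.
  by have ? := is_derive_pair (is_derive_affine_trig w c x.1.1.1 x.1.1.2 x.1.2 x.2 t)
    (is_derive_affine_trig w c y.1.1.1 y.1.1.2 y.1.2 y.2 t); exact: ex_derive.
have Dpair n : exists x y,
    (polar (fun t => a + b * t) (fun t => c + w * t))^`(n)%classic = pair x y.
  elim: n => [|n [x [y IH]]].
    exists (a, b, 0, 0), (0, 0, a, b); apply/funext => t.
    by rewrite derive1n0 /pair /affine_trig /polar/=; congr (_, _); ring.
  pose next (x : R * R * R * R) : R * R * R * R :=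
    (x.1.1.2 + w * x.1.2, w * x.2, x.2 - w * x.1.1.1, - (w * x.1.1.2)).
  exists (next x), (next y); apply/funext => t; rewrite derive1nS IH derive1E.
  have ? := is_derive_pair (is_derive_affine_trig w c x.1.1.1 x.1.1.2 x.1.2 x.2 t)
    (is_derive_affine_trig w c y.1.1.1 y.1.1.2 y.1.2 y.2 t).
  by rewrite derive_val.
by move=> n t; have [x [y ->]] := Dpair n.
Qed.

End smooth_polar.

(** * Length of affine polar curves *)

Section curve_length.
Variables (R : realType) (u : R * R -> R).
Hypothesis u_smooth : smooth u.
Hypothesis u_radial : radially_symmetric u.
Local Notation leb := (@lebesgue_measure R).
Local Notation f := (radial_part u).

Definition length_density (c : R -> R * R) (t : R) : R :=
  expR (u (c t)) * enorm (c^`()%classic t).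

Lemma length_density_ge0 c t : 0 <= length_density c t.
Proof. by rewrite mulr_ge0 ?expR_ge0 ?enorm_ge0. Qed.

(** The length of a piece does not see the end points, where [c] may differ from
    its smooth extension [h] to first order; measurability is recorded for the
    sake of [glength_cat]. *)
Lemma glength_eq (c h : R -> R * R) (a b : R) :
  continuous (length_density h) -> {in `[a, b], c =1 h} ->
  measurable_fun `[a, b] (EFin \o length_density c) /\
  glength u a b c = glength u a b h.
Proof.
move=> ch ceh.
have eqoo : {in `]a, b[, length_density h =1 length_density c}.
  move=> t tab; rewrite /length_density ceh; last exact: subset_itv_oo_cc.
  suff -> : c^`()%classic t = h^`()%classic t by [].
  rewrite !derive1E; apply: near_eq_derive.
  have := near_in_itvoo tab; apply: filterS => s sab.
  by rewrite ceh//; exact: subset_itv_oo_cc.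
have mh : measurable_fun `]a, b[ (length_density h).
  apply: (measurable_funS measurableT) => //.
  exact: continuous_measurable_fun.
have mc : measurable_fun `]a, b[ (length_density c).
  by apply: eq_measurable_fun mh => t; rewrite inE/=; exact: eqoo.
split.
  apply/measurable_EFinP; apply/measurable_fun_itv_bndo_bndcP.
  exact/measurable_fun_itv_obnd_cbndP.
rewrite /glength /curve_integral.
exact: (@eq_integral_itv_bounded R a b (length_density h) (length_density c)
  true false mc mh (fun t tab => esym (eqoo t tab))).
Qed.

Lemma glength_cat (c : R -> R * R) (a b d : R) : a <= b -> b <= d ->
  measurable_fun `[a, b] (EFin \o length_density c) ->
  measurable_fun `[b, d] (EFin \o length_density c) ->
  measurable_fun `[a, d] (EFin \o length_density c) /\
  glength u a d c = (glength u a b c + glength u b d c)%E.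
Proof.
move=> ab bd mab mbd.
have mbd' : measurable_fun `]b, d] (EFin \o length_density c).
  exact/emeasurable_fun_itv_obnd_cbndP.
have sE : `[a, d]%classic = `[a, b]%classic `|` `]b, d]%classic.
  by rewrite -itv_bndbnd_setU// bnd_simp.
have mad : measurable_fun `[a, d] (EFin \o length_density c).
  by rewrite sE; apply/measurable_funU.
split => //; rewrite /glength /curve_integral sE ge0_integral_setU//.
- by congr (_ + _)%E; exact: integral_itv_obnd_cbnd.
- by rewrite -sE.
- by move=> t _; rewrite lee_fin; exact: length_density_ge0.
- apply/disj_set2P/seteqP; split => // t [] /=.
  by rewrite !in_itv/= => /andP[_ tb] /andP[bt _]; move: (lt_le_trans bt tb); rewrite ltxx.
Qed.

Section affine_polar.
Variables (a b p w : R).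
Let h := polar (fun t => a + b * t) (fun t => p + w * t).

Lemma length_density_polar t : length_density h t =
  expR (u (h t)) * Num.sqrt (b ^+ 2 + ((a + b * t) * w) ^+ 2).
Proof.
by rewrite /length_density (enorm_derive_polar (is_derive_affine a b t) (is_derive_affine p w t)).
Qed.

Lemma continuous_affine (x y : R) : continuous (fun t : R => x + y * t).
Proof.
move=> t; apply/differentiable_continuous/derivable1_diffP.
by have ? := is_derive_affine x y t; exact: ex_derive.
Qed.

Lemma continuous_polar_affine : continuous h.
Proof.
move=> t; apply/differentiable_continuous/derivable1_diffP.
have ? := is_derive_polar (is_derive_affine a b t) (is_derive_affine p w t).
exact: ex_derive.
Qed.

Lemma continuous_length_density_polar : continuous (length_density h).
Proof.
rewrite (_ : length_density h = (fun t => expR (u (h t))) \*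
    (fun t => Num.sqrt (b * b + ((a + b * t) * w) * ((a + b * t) * w)))); last first.
  by apply/funext => t; rewrite length_density_polar.
move=> t; apply: continuousM.
  have cu := continuous_comp (continuous_polar_affine (x := t)) (u_continuous u_smooth (x := h t)).
  exact: (continuous_comp cu (@continuous_expR R _)).
have ca := @continuous_affine a b t.
have cw := continuousM ca (@cst_continuous _ _ (w : R) t).
have cs := continuousD (@cst_continuous _ _ (b * b : R) t) (continuousM cw cw).
exact: (continuous_comp cs (@sqrt_continuous R _)).
Qed.

End affine_polar.

Lemma glength_arc (t0 t1 rho p w : R) : 0 <= rho -> t0 <= t1 ->
  glength u t0 t1 (polar (fun t => rho + 0 * t) (fun t => p + w * t)) =
  (rho * expR (f rho) * `|w| * (t1 - t0))%:E.
Proof.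
move=> rho0 t01; rewrite /glength /curve_integral.
rewrite (eq_integral (cst (rho * expR (f rho) * `|w|)%:E)); last first.
  move=> t _; congr EFin.
  rewrite -[LHS]/(length_density _ t) length_density_polar.
  rewrite {1}/polar (radialE u_radial) mul0r addr0 enorm_polar// expr0n/= add0r.
  by rewrite sqrtr_sqr normrM (ger0_norm rho0); ring.
rewrite integral_cst//= lebesgue_measure_itv/= lte_fin.
case: ltP => [_|]; first by rewrite -EFinB -EFinM.
by move=> t10; rewrite mule0 (_ : t1 - t0 = 0) ?mulr0//; lra.
Qed.

(** [t |-> gradius u (a + b t)], up to the sign of [b], is an antiderivative of
    the length density inside the interval, where [a + b t] is positive. *)
Lemma glength_radial (t0 t1 a b p : R) : t0 < t1 ->
  0 <= a + b * t0 -> 0 <= a + b * t1 ->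
  (glength u t0 t1 (polar (fun t => a + b * t)%R (fun t => p + 0 * t)%R) <=
   (`|gradius u (a + b * t1) - gradius u (a + b * t0)|)%R%:E)%E.
Proof.
move=> t01 q0 q1; rewrite /glength /curve_integral.
have qge0 t : t0 <= t <= t1 -> 0 <= a + b * t by nra.
pose g (t : R) := expR (f (a + b * t)) * `|b|.
rewrite [leLHS](_ : _ = (\int[leb]_(t in `[t0, t1]) (g t)%:E)%E); last first.
  apply: eq_integral => t; rewrite inE/= in_itv/= => /qge0 qt; congr EFin.
  rewrite -[LHS]/(length_density _ t) length_density_polar.
  rewrite {1}/polar (radialE u_radial) mulr0 enorm_polar// expr0n/= addr0.
  by rewrite sqrtr_sqr.
have cg : continuous g.
  move=> t; have ce := continuous_comp (@continuous_affine a b t)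
    (@continuous_radial_exp R u u_smooth (a + b * t)).
  exact: (continuousM ce (@cst_continuous _ _ (`|b| : R) t)).
(* A constant modulus, possibly [0], where [gradius u] has no derivative. *)
have [b0|b0] := eqVneq b 0.
  rewrite integral0_eq ?lee_fin// => t _.
  by rewrite /= /g b0 normr0 mulr0.
have qgt0 t : t0 < t < t1 -> 0 < a + b * t.
  move=> /andP[tl tr]; have [bn|bp|/eqP] := ltgtP b 0; [by nra|by nra|].
  by rewrite (negPf b0).
pose F (t : R) := Num.sg b * gradius u (a + b * t).
have cF : continuous F.
  move=> t; have ce := continuous_comp (@continuous_affine a b t)
    (@continuous_gradius R u u_smooth (a + b * t)).
  exact: (continuousM (@cst_continuous _ _ (Num.sg b : R) t) ce).
have dF (t : R) : t0 < t < t1 -> is_derive t 1 F (g t).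
  move=> /qgt0 qt.
  have dd := is_deriveZ (Num.sg b) (is_derive1_comp (g := fun s => a + b * s)
    (is_derive_gradius u_smooth qt) (is_derive_affine a b t)).
  apply: is_derive_eq; rewrite /GRing.scale/= /g normrEsg; ring.
rewrite (continuous_FTC2 (f := g) (F := F) t01).
- rewrite -EFinB lee_fin /F -mulrBr.
  by rewrite (le_trans (ler_norm _))// normrM normr_sg b0 mul1r.
- exact: continuous_subspaceT.
- split => [t||].
  + by rewrite in_itv/= => /dF ?; exact: ex_derive.
  + by apply: cvg_at_right_filter; exact: cF.
  + by apply: cvg_at_left_filter; exact: cF.
- by move=> t; rewrite in_itv/= => /dF ?; rewrite derive1E derive_val.
Qed.

End curve_length.

(** * Diameter *)

Section diameter.
Variables (R : realType) (u : R * R -> R).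
Hypothesis u_smooth : smooth u.
Hypothesis u_radial : radially_symmetric u.
Local Notation f := (radial_part u).

Section three_pieces.
Variables (q1 p1 q2 p2 rho : R).

Definition piece_in := polar (fun t => q1 + (rho - q1) * t) (fun t => p1 + 0 * t).
Definition piece_arc :=
  polar (fun t => rho + 0 * t) (fun t => (p1 - (p2 - p1)) + (p2 - p1) * t).
Definition piece_out :=
  polar (fun t => (rho - 2 * (q2 - rho)) + (q2 - rho) * t) (fun t => p2 + 0 * t).

(** From [(q1, p1)] in polar coordinates along a ray to the circle of radius
    [rho], along that circle to the angle [p2], and along a ray to [(q2, p2)].
    For [rho = 0] this is the path through the origin.  All moduli
    and angles, also the constant ones, have the shape [a + b t] of
    [smooth_polar_affine], with coefficients such that the pieces are run on
    successive unit intervals from [0] to [3]. *)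
Definition three_piece_curve (t : R) : R * R :=
  if t <= 1 then piece_in t else if t <= 2 then piece_arc t else piece_out t.
Local Notation c := three_piece_curve.

Lemma three_piece_in : {in `[0, 1], c =1 piece_in}.
Proof. by move=> t; rewrite in_itv/= /c => /andP[_ ->]. Qed.

Lemma three_piece_arc : {in `[1, 2], c =1 piece_arc}.
Proof.
move=> t; rewrite in_itv/= /c => /andP[t1 ->].
case: ifPn => // t1'; have -> : t = 1 by apply/eqP; rewrite eq_le t1 t1'.
by rewrite /piece_in /piece_arc /polar; congr (_ * cos _, _ * sin _); ring.
Qed.

Lemma three_piece_out : {in `[2, 3], c =1 piece_out}.
Proof.
move=> t; rewrite in_itv/= /c => /andP[t2 _].
rewrite ifN; last by rewrite -ltNge; lra.
case: ifPn => // t2'; have -> : t = 2 by apply/eqP; rewrite eq_le t2 t2'.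
by rewrite /piece_out /piece_arc /polar; congr (_ * cos _, _ * sin _); ring.
Qed.

Lemma within_eq_continuous (g h : R -> R * R) (a b : R) :
  continuous h -> {in `[a, b], g =1 h} -> {within `[a, b], continuous g}.
Proof.
move=> ch gh; apply: (@subspace_eq_continuous _ _ _ h).
  by move=> t; rewrite inE/= => tab; apply: esym; exact: gh.
exact: continuous_subspaceT.
Qed.

Lemma piecewise_smooth_three_piece : piecewise_smooth 0 3 c.
Proof.
split.
  have -> : `[0, 3]%classic = (`[0, 1]%classic `|` `[1, 2]%classic) `|` `[2, 3]%classic :> set R.
    apply/seteqP; split => t /=; rewrite !in_itv/=.
      move=> /andP[t0 t3]; have [t1|t1] := leP t 1.
        by left; left; rewrite t0.
      have [t2|t2] := leP t 2; first by left; right; rewrite ltW.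
      by right; rewrite ltW.
    by move=> [[]|] /andP[a b]; apply/andP; split; lra.
  apply: withinU_continuous; [|exact: itv_closed| |].
  - by apply: closedU; exact: itv_closed.
  - apply: withinU_continuous; [exact: itv_closed|exact: itv_closed| |].
    + apply: within_eq_continuous three_piece_in; exact: continuous_polar_affine.
    + apply: within_eq_continuous three_piece_arc; exact: continuous_polar_affine.
  - apply: within_eq_continuous three_piece_out; exact: continuous_polar_affine.
exists [:: 1; 2; 3].
  by split => //=; rewrite ltr01 ltr1n ltr_nat.
case=> [|[|[|//]]] _ /=.
- by exists piece_in; [exact: smooth_polar_affine|exact: three_piece_in].
- by exists piece_arc; [exact: smooth_polar_affine|exact: three_piece_arc].
- by exists piece_out; [exact: smooth_polar_affine|exact: three_piece_out].
Qed.

Lemma glength_three_piece : 0 <= q1 -> 0 <= q2 -> 0 <= rho ->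
  (glength u 0%R 3%R c <= (`|gradius u rho - gradius u q1| +
    rho * expR (f rho) * `|p2 - p1| + `|gradius u q2 - gradius u rho|)%R%:E)%E.
Proof.
move=> q10 q20 rho0.
have d_in := @continuous_length_density_polar R u u_smooth q1 (rho - q1) p1 0.
have d_arc := @continuous_length_density_polar R u u_smooth rho 0 (p1 - (p2 - p1)) (p2 - p1).
have d_out := @continuous_length_density_polar R u u_smooth (rho - 2 * (q2 - rho)) (q2 - rho) p2 0.
have [m1 g1] := glength_eq d_in three_piece_in.
have [m2 g2] := glength_eq d_arc three_piece_arc.
have [m3 g3] := glength_eq d_out three_piece_out.
have [m12 g12] : _ /\ _ := @glength_cat R u c 0 1 2 ler01 ltac:(by rewrite ler1n) m1 m2.
have [_ g03] : _ /\ _ := @glength_cat R u c 0 2 3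
  ltac:(by rewrite ler0n) ltac:(by rewrite ler_nat) m12 m3.
rewrite (etrans g03 (f_equal2 adde (etrans g12 (f_equal2 adde g1 g2)) g3)).
have r2 := @glength_arc R u u_radial 1 2 rho (p1 - (p2 - p1)) (p2 - p1) rho0
  ltac:(by rewrite ler1n).
rewrite (_ : 2 - 1 = 1) ?mulr1 in r2; last by ring.
have r1 := @glength_radial R u u_smooth u_radial 0 1 q1 (rho - q1) p1 ltr01.
rewrite mulr0 addr0 mulr1 [q1 + _]addrC subrK in r1.
have r3 := @glength_radial R u u_smooth u_radial 2 3 (rho - 2 * (q2 - rho)) (q2 - rho) p2.
rewrite (_ : rho - _ + _ * 2 = rho) in r3; last by ring.
rewrite (_ : rho - _ + _ * 3 = q2) in r3; last by ring.
have t23 : 2 < 3 :> R by rewrite ltr_nat.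
rewrite 2!EFinD; apply: leeD; last exact: r3 t23 rho0 q20.
by apply: leeD; [exact: r1 q10 rho0|rewrite -r2].
Qed.

End three_pieces.

(** The factor [d] is the difference of the angles of [x] and [y]. *)
Lemma gdist_le (x y : R * R) : exists d : R, forall rho, 0 <= rho ->
  (gdist u x y <= (`|gradius u rho - gradius u (enorm x)| +
    rho * expR (f rho) * d +
    `|gradius u (enorm y) - gradius u rho|)%R%:E)%E.
Proof.
have [p1 xE] := polar_form x; have [p2 yE] := polar_form y.
exists `|p2 - p1| => rho rho0.
apply: le_trans (glength_three_piece p1 p2 (enorm_ge0 x) (enorm_ge0 y) rho0).
apply: ereal_inf_lbound => /=.
exists 0, 3, (three_piece_curve (enorm x) p1 (enorm y) p2 rho); split => //.
- exact: piecewise_smooth_three_piece.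
- rewrite three_piece_in ?in_itv/= ?lexx ?ler01// [RHS]xE /piece_in /polar.
  by congr (_ * cos _, _ * sin _); ring.
- rewrite three_piece_out ?in_itv/= ?lexx ?ler_nat// [RHS]yE /piece_out /polar.
  by congr (_ * cos _, _ * sin _); ring.
Qed.

Hypothesis u_ineq : forall p : R * R, laplacian u p + expR (2 * u p) <= 0.

(** Through the origin if the distances of [x] and [y] to it add up to at most
    [pi]; otherwise through a circle so large that its length is negligible. *)
Lemma gdist_le_pi (x y : R * R) : (gdist u x y <= pi%:E)%E.
Proof.
have P := radial_profile_of_metric u_smooth u_radial u_ineq.
have T0 r : 0 <= r -> 0 <= gradius u r.
  rewrite le_eqVlt => /predU1P[<-|/(rp_T_gt0 P)/ltW//].
  by rewrite gradius_le0.
have x0 := T0 _ (enorm_ge0 x); have y0 := T0 _ (enorm_ge0 y).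
have Tpi r := @gradius_lt_pi R u u_smooth u_radial u_ineq r.
have [d dle] := gdist_le x y.
have [xy|xy] := leP (gradius u (enorm x) + gradius u (enorm y)) pi.
  apply: (le_trans (dle 0 (lexx _))).
  have -> : gradius u 0 = 0 by exact: gradius_le0.
  rewrite lee_fin sub0r normrN subr0 (ger0_norm x0) (ger0_norm y0).
  by rewrite -mulrA mul0r addr0.
apply/lee_addgt0Pr => e e0.
have [r0 r00 hr0] := rp_turning_point P.
have e1 : 0 < e / (`|d| + 1) by rewrite divr_gt0// ltr_wpDl.
have [|s r0s sL] := rp_L_small P r00 _ e1; first by rewrite hr0.
pose rho := Num.max s (Num.max (enorm x) (enorm y)).
have xrho : enorm x <= rho by rewrite !le_max lexx !orbT.
have yrho : enorm y <= rho by rewrite !le_max lexx !orbT.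
have srho : s <= rho by rewrite le_max lexx.
have rho0 : 0 <= rho by exact: le_trans (enorm_ge0 x) xrho.
have Tmono r : 0 <= r -> r <= rho -> gradius u r <= gradius u rho.
  by move=> ?; rewrite le_eqVlt => /predU1P[->//|?]; rewrite ltW// (rp_T_lt P).
have Tx := Tmono _ (enorm_ge0 x) xrho; have Ty := Tmono _ (enorm_ge0 y) yrho.
apply: (le_trans (dle rho rho0)).
rewrite -EFinD lee_fin ger0_norm ?subr_ge0// ler0_norm ?subr_le0//.
have Ld : rho * expR (f rho) * d <= e.
  apply: (@le_trans _ _ (e / (`|d| + 1) * (`|d| + 1))).
    apply: (@le_trans _ _ (rho * expR (f rho) * (`|d| + 1))).
      by rewrite ler_wpM2l ?mulr_ge0 ?expR_ge0// (le_trans (ler_norm _))// lerDl.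
    by rewrite ler_wpM2r ?addr_ge0// ltW// sL.
  by rewrite divfK// gt_eqF// ltr_wpDl.
have Trho := Tpi rho rho0; clear -Ld Trho xy; lra.
Qed.

Lemma gdiam_le_pi : (gdiam u <= pi%:E)%E.
Proof. by apply: ge_ereal_sup => _ [x [y ->]]; exact: gdist_le_pi. Qed.

End diameter.

Theorem theorem1p5 (R : realType) (u : R * R -> R)
    (u_smooth : smooth u)
    (u_radial : radially_symmetric u)
    (u_ineq : forall p : R * R, laplacian u p + expR (2 * u p) <= 0) :
  let l := circle_length u in
  let A := disk_area u in
  let Aoo := total_area u in
  let Rad := gradius u in
  ((gvol u <= (4 * pi)%:E)%E /\ (gdiam u <= pi%:E)%E) /\
  exists r0 : R, 0 < r0 /\
    [/\ [/\ forall r s : R, 0 < r -> r < s -> s < r0 -> l r < l s,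
            forall r s : R, r0 < r -> r < s -> l s < l r,
            forall r : R, 0 < r -> l r <= l r0,
            l r0 <= 2 * pi
          & l r @[r --> +oo] --> (0 : R)],
        forall r : R, 0 < r ->
          A r * (Aoo - A r) <= l r ^+ 2 /\
          l r ^+ 2 <= 4 * pi * A r - A r ^+ 2,
        Rad r0 <= pi / 2 /\
        (forall r : R, 0 < r ->
          Aoo * (1 - cos (Rad r)) <= 2 * A r /\
          (1 - cos (Rad r)) / sin (Rad r) <= A r / l r),
        forall r : R, 0 < r -> r <= r0 ->
          A r / l r <= sin (Rad r) /\ A r <= l r
      & forall r : R, 0 < r -> pi / 2 <= Rad r -> Aoo / 2 <= A r].
Proof.
move=> l A Aoo Rad; split.
  by split; [exact: gvol_le_4pi|exact: gdiam_le_pi].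
have P := radial_profile_of_metric u_smooth u_radial u_ineq.
set L := (fun r => r * _) in P; set h := (fun r => 1 + _) in P.
set a := (fun r => _ / _) in P; rewrite -/Rad in P.
pose c : R := 2 * pi; have c0 : 0 < c by rewrite mulr_gt0 ?pi_gt0.
have lE r : 0 <= r -> l r = c * L r by move=> r0; rewrite /l circle_lengthE.
have AE r : A r = c * a r by exact: disk_areaM.
pose aoo : R := Aoo / c; have AooE : Aoo = c * aoo by rewrite mulrC divfK ?gt_eqF.
have a_le r : 0 < r -> a r <= aoo.
  move=> _; rewrite /a ler_pM2r ?invr_gt0//.
  exact: disk_area_le_total.
have a_sup (e : R) : 0 < e -> exists2 r : R, 0 < r & aoo - e < a r.
  exact: total_area_sup.
have cE : c = 2 * pi by [].
clearbody aoo a h L l A Aoo Rad c.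
have [r0 r00 hr0] := rp_turning_point P.
have L_incr r s : 0 <= r -> r < s -> s <= r0 -> L r < L s.
  move=> r1 rs sr0; apply: (rp_L_incr P) => //; rewrite -hr0.
  have s0 : 0 <= s by exact: le_trans r1 (ltW rs).
  move: sr0; rewrite le_eqVlt => /predU1P[->//|sr0].
  by rewrite ltW// (rp_h_lt P).
have L_decr r s : r0 <= r -> r < s -> L s < L r.
  move=> r0r rs; have r1 := le_trans (ltW r00) r0r; apply: (rp_L_decr P) => //.
  rewrite -hr0; move: r0r; rewrite le_eqVlt => /predU1P[->//|r0r].
  by rewrite ltW// (rp_h_lt P)// ltW.
have h_ge0 r : 0 < r -> r <= r0 -> 0 <= h r.
  move=> r1; rewrite -hr0 le_eqVlt => /predU1P[->//|rr0].
  by rewrite ltW// (rp_h_lt P)// ltW.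
have cap r : 0 < r -> Aoo * (1 - cos (Rad r)) <= 2 * A r.
  move=> r1; rewrite AooE AE -mulrA [leRHS]mulrCA ler_pM2l//.
  exact: (rp_aoo_cap P a_sup).
exists r0; split; [exact: r00|split].
- split.
  + move=> r s r1 rs sr0; have s1 := lt_trans r1 rs.
    by rewrite !lE ?ltW// ltr_pM2l// L_incr// ltW.
  + move=> r s r0r rs; have r1 := lt_trans r00 r0r; have s1 := lt_trans r1 rs.
    by rewrite !lE ?(ltW r1) ?(ltW s1)// ltr_pM2l// L_decr// ltW.
  + move=> r r1; rewrite !lE ?(ltW r1) ?(ltW r00)// ler_pM2l//.
    have [rr0|r0r|->//] := ltgtP r r0; apply: ltW.
      by rewrite L_incr// ltW.
    by rewrite L_decr.
  + by rewrite -cE lE ?(ltW r00)// ler_piMr ?(ltW c0)//; exact: rp_L_le1 P _ (ltW r00).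
  + have cL : (c * L r) @[r --> +oo] --> (0 : R).
      by rewrite -(mulr0 c); apply: cvgMr; exact: rp_L_cvg0 P.
    apply: cvg_trans cL; apply: near_eq_cvg; near=> r.
    rewrite lE//; near: r; exact: nbhs_pinfty_ge.
- move=> r r1; rewrite lE ?(ltW r1)// AE AooE exprMn; split.
    rewrite -mulrBr mulrACA -expr2 ler_pM2l ?exprn_gt0//.
    exact: (rp_reverse_isoperimetric P a_le a_sup).
  have := rp_isoperimetric P (ltW r1); rewrite -(ler_pM2l (exprn_gt0 2 c0)).
  by rewrite (_ : 4 * pi = 2 * c) ?cE; [congr (_ <= _); ring|ring].
- split; first by apply: (rp_T_le_pihalf P) => //; rewrite hr0.
  move=> r r1; split; first exact: cap.
  have sin0 := rp_sin_gt0 P r1; have L0 := rp_L_gt0 P r1.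
  rewrite lE ?(ltW r1)// AE invfM mulrACA divff ?gt_eqF// mul1r.
  rewrite ler_pdivrMr// mulrAC ler_pdivlMr// mulrC.
  exact: rp_cap P _ r1.
- move=> r r1 rr0; have L0 := rp_L_gt0 P r1.
  have aL := rp_a_le_Lsin P r1 (h_ge0 r r1 rr0).
  rewrite lE ?(ltW r1)// AE; split.
    by rewrite invfM mulrACA divff ?gt_eqF// mul1r ler_pdivrMr// mulrC.
  by rewrite ler_pM2l// (le_trans aL)// ler_piMr ?(ltW L0)// sin_le1.
- move=> r r1 piR; rewrite ler_pdivrMr// [A r * 2]mulrC.
  apply: le_trans (cap r r1); rewrite ler_peMr.
  + by [].
  + by rewrite AooE mulr_ge0 ?(ltW c0)// (ltW (rp_aoo_gt0 P a_le)).
  + rewrite lerDl oppr_ge0.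
    rewrite (_ : Rad r = Rad r - pi / 2 + pi / 2); last by rewrite subrK.
    rewrite cosDpihalf oppr_le0 sin_ge0_pi// subr_ge0 piR/=.
    by have := rp_T_lt_pi P (ltW r1); have := @pi_gt0 R; lra.
Unshelve. all: by end_near. Qed.
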